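(* Let $G$ be a six-dimensional non-nilpotent almost abelian Lie group. Then $G$ admits a left-invariant SKT structure $(J,g)$ with $J$ having non-trivial left-invariant holomorphic Poisson structures if and only if its Lie algebra $\mathfrak{g}$ is isomorphic to one of the following: - $\mathfrak{k}_{11}^{p,0,0,1}=(pf^{16},f^{36},-f^{26},f^{56},-f^{46},0)$, $p\in\mathbb{R}$, $p\neq0$; - $\mathfrak{k}_{13}=(f^{16},0,0,0,0,0)$; - $\mathfrak{k}_{15}^0=(f^{26},-f^{16},0,0,0,0)$; - $\mathfrak{k}_{23}^0=(f^{26},-f^{16},f^{46},0,0,0)$; - $\mathfrak{k}_{25}^{0,0,1}=(f^{26},-f^{16},f^{46},-f^{36},0,0)$. In particular, if $G$ is unimodular (and admits such a structure), then its Lie algebra has to be decomposable (i.e. a direct sum of two non-zero Lie algebras), being isomorphic to either $\mathfrak{k}_{15}^0$, $\mathfrak{k}_{23}^0$ or $\mathfrak{k}_{25}^{0,0,1}$.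
   Context: An almost abelian Lie group is a (real) connected Lie group whose Lie algebra has a codimension-one abelian ideal; throughout, such groups are assumed connected and simply connected. Notation for Lie algebras: $(\alpha_1,\ldots,\alpha_6)$ denotes the real six-dimensional Lie algebra with a basis of 1-forms $\{f^1,\ldots,f^6\}$ satisfying $df^i=\alpha_i$, where $d$ is the Chevalley–Eilenberg differential ($d\alpha(X,Y)=-\alpha([X,Y])$ for a 1-form $\alpha$) and $f^{ij}=f^i\wedge f^j$. A Hermitian structure $(J,g)$ is a pair of an (integrable) complex structure $J$ and a Riemannian metric $g$ with $g(J\cdot,J\cdot)=g(\cdot,\cdot)$; its fundamental form is $\omega(\cdot,\cdot)=g(J\cdot,\cdot)$. It is SKT (pluriclosed) if $\partial\overline\partial\omega=0$. Left-invariant structures on $G$ are identified with the corresponding algebraic structures on $\mathfrak{g}$. Given a complex structure $J$ on $\mathfrak{g}$, let $\mathfrak{g}\otimes\mathbb{C}=\mathfrak{g}^{1,0}\oplus\mathfrak{g}^{0,1}$ be the decomposition into $(\pm i)$-eigenspaces of $J$. For $X\in\mathfrak{g}^{0,1}$, $Y\in\mathfrak{g}^{1,0}$ set $\overline\partial_XY=[X,Y]^{1,0}$, and extend to $\mathfrak{g}^{2,0}=\Lambda^2\mathfrak{g}^{1,0}$ by $\overline\partial_X(Y\wedge Z)=\overline\partial_XY\wedge Z+Y\wedge\overline\partial_XZ$. The Schouten bracket of bivectors is determined bilinearly by $[X_0\wedge X_1,Y_0\wedge Y_1]=\sum_{j,k=0}^1(-1)^{j+k}[X_j,Y_k]\wedge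 X_{j+1}\wedge Y_{k+1}$ (indices mod 2). A left-invariant holomorphic Poisson structure is $\pi\in\mathfrak{g}^{2,0}$ with $\overline\partial_X\pi=0$ for all $X\in\mathfrak{g}^{0,1}$ and $[\pi,\pi]=0$; it is non-trivial if $\pi\neq0$. *)

(* Defs.v *)
From HB Require Import structures.
From mathcomp Require Import all_boot all_order all_algebra.
From mathcomp Require Export sesquilinear.
From mathcomp Require Export complex reals.
From mathcomp Require Import ring.

Set Implicit Arguments.
Unset Strict Implicit.
Unset Printing Implicit Defensive.

Import Order.TTheory GRing.Theory Num.Theory.
Local Open Scope ring_scope.
Local Open Scope complex_scope.

(** * Finite-dimensional Lie algebras *)

Record lieAlgebra (F : fieldType) := LieAlgebra {
  lie_space :> vectType F;
  bracket : {bilinear lie_space -> lie_space -> lie_space};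
  bracket_alternating : forall x, bracket x x = 0;
  bracket_jacobi : forall x y z,
    bracket x (bracket y z) + bracket y (bracket z x)
      + bracket z (bracket x y) = 0 }.

Arguments bracket {F l} : rename.

Section LieTheory.
Variable F : fieldType.
Implicit Types g h : lieAlgebra F.

Definition lie_isomorphic g h : Prop :=
  exists f : {linear g -> h},
    bijective f /\ forall x y, f (bracket x y) = bracket (f x) (f y).

Definition is_ideal g (A : {vspace g}) : Prop :=
  forall x y, y \in A -> bracket x y \in A.

Definition is_abelian_subspace g (A : {vspace g}) : Prop :=
  forall x y, x \in A -> y \in A -> bracket x y = 0.

Definition almost_abelian g : Prop :=
  exists A : {vspace g},
    [/\ (\dim A).+1 = \dim {:g}, is_ideal A & is_abelian_subspace A].

Definition bracket_space g (U V : {vspace g}) : {vspace g} :=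
  <<[seq bracket u v | u <- vbasis U, v <- vbasis V]>>%VS.

Fixpoint lower_central g (k : nat) : {vspace g} :=
  if k is k'.+1 then bracket_space fullv (lower_central g k') else fullv.

Definition nilpotent_lie g : Prop := exists k, lower_central g k = 0%VS.

(* A connected Lie group is unimodular iff every [ad x] is traceless. *)
Definition unimodular g : Prop :=
  forall x : g,
    \tr (passmx.mxof (vbasis {:g}) (vbasis {:g}) (linfun (bracket x))) = 0.

Section DirectSum.
Variables g h : lieAlgebra F.

Definition sum_bracket (x y : g * h) : g * h :=
  (bracket x.1 y.1, bracket x.2 y.2).

Fact sum_bracket_bilinear : bilinear_for *:%R *:%R sum_bracket.
Proof.
split=> [u a x y | u a x y]; rewrite /sum_bracket /applyr /=.
  by rewrite !linearPl.
by rewrite !linearPr.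
Qed.
HB.instance Definition _ :=
  bilinear_isBilinear.Build F (g * h)%type (g * h)%type (g * h)%type _ _
    sum_bracket sum_bracket_bilinear.

Fact sum_bracket_alternating x : sum_bracket x x = 0.
Proof. by rewrite /sum_bracket !bracket_alternating. Qed.

Fact sum_bracket_jacobi x y z :
  sum_bracket x (sum_bracket y z) + sum_bracket y (sum_bracket z x)
    + sum_bracket z (sum_bracket x y) = 0.
Proof. by congr (_, _); rewrite /= bracket_jacobi. Qed.

Definition lie_sum : lieAlgebra F :=
  LieAlgebra sum_bracket_alternating sum_bracket_jacobi.
End DirectSum.

Definition decomposable g : Prop :=
  exists g1 g2 : lieAlgebra F,
    [/\ (0 < \dim {:g1})%N, (0 < \dim {:g2})%N
      & lie_isomorphic g (lie_sum g1 g2)].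
End LieTheory.

(** * Lie algebras given by structure equations *)

Section StructureEquations.
Variable F : fieldType.

(* The 2-form $f^{jk} = f^j \wedge f^k$ on $F^6$ (indices from 1 to 6), as the
   matrix of $(x, y) \mapsto x_j y_k - x_k y_j$. *)
Definition f2 (j k : nat) : 'M[F]_6 :=
  delta_mx (inord j.-1) (inord k.-1) - delta_mx (inord k.-1) (inord j.-1).

(* The bracket of [(al_1, ..., al_6)]: since $df^i(x,y) = -f^i([x,y])$, the
   [i]-th coordinate of [[x, y]] is $-\alpha_i(x,y)$. *)
Definition str_bracket (al : seq 'M[F]_6) (x y : 'rV[F]_6) : 'rV[F]_6 :=
  - \row_(i < 6) (x *m al`_i *m y^T) 0 0.

Fact str_bracketE al x y i :
  str_bracket al x y 0 i = - (x *m al`_i *m y^T) 0 0.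
Proof. by rewrite !mxE. Qed.

Fact str_bracket_bilinear al : bilinear_for *:%R *:%R (str_bracket al).
Proof.
have sE (c : F) (M N : 'M[F]_1) : (c *: M + N) 0 0 = c * M 0 0 + N 0 0.
  by rewrite !mxE.
split=> [u a x y | u a x y]; apply/rowP=> i;
  rewrite str_bracketE [RHS]mxE [X in _ = X + _]mxE !str_bracketE.
  by rewrite !mulmxDl -!scalemxAl sE; ring.
by rewrite linearP mulmxDr -scalemxAr sE; ring.
Qed.
HB.instance Definition _ al :=
  bilinear_isBilinear.Build F 'rV[F]_6 'rV[F]_6 'rV[F]_6 _ _
    (str_bracket al) (str_bracket_bilinear al).

Definition lie_equations (al : seq 'M[F]_6) : Prop :=
  (forall x, str_bracket al x x = 0) /\
  (forall x y z,
    str_bracket al x (str_bracket al y z) + str_bracket al y (str_bracket al z x)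
      + str_bracket al z (str_bracket al x y) = 0).

Definition lie_of_equations al (H : lie_equations al) : lieAlgebra F :=
  LieAlgebra (proj1 H) (proj2 H).

Fact scale_f2E c j k (x y : 'rV[F]_6) :
  (x *m (c *: f2 j k) *m y^T) 0 0
  = c * (x 0 (inord j.-1) * y 0 (inord k.-1)
         - x 0 (inord k.-1) * y 0 (inord j.-1)).
Proof.
have dE (a b : 'I_6) : (x *m delta_mx a b *m y^T) 0 0 = x 0 a * y 0 b.
  rewrite mxE (bigD1 b) //= big1 ?addr0 => [|d db]; last first.
    by rewrite mxE big1 ?mul0r // => d' _; rewrite mxE (negPf db) andbF mulr0.
  rewrite mxE (bigD1 a) //= big1 ?addr0 => [|d da].
    by rewrite !mxE !eqxx mulr1.
  by rewrite mxE (negPf da) mulr0.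
rewrite -scalemxAr -scalemxAl /f2 mulmxBr mulmxBl -!dE.
by rewrite mxE; congr (_ * _); rewrite mxE; congr (_ + _); rewrite mxE.
Qed.

(* The bracket then has the form [x, y] = x_6 D(y) - y_6 D(x), where D takes its
   values in the hyperplane x_6 = 0. *)
Fact lie_equations_f6 (al : seq 'M[F]_6) :
    (forall i : 'I_6, exists c j, al`_i = c *: f2 j 6) -> al`_5 = 0 ->
  lie_equations al.
Proof.
move=> alE al5; pose e : 'rV[F]_6 := delta_mx 0 (inord 5).
pose D := str_bracket al e.
have BE x y : str_bracket al x y
    = x 0 (inord 5) *: D y - y 0 (inord 5) *: D x.
  apply/rowP=> i; have [c [j aliE]] := alE i.
  rewrite [RHS]mxE [X in _ = _ + X]mxE [X in _ = X - _]mxE [X in _ - X]mxE.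
  rewrite !str_bracketE aliE !scale_f2E [e 0 (inord 6.-1)]mxE !eqxx /=; ring.
have BB x y z : str_bracket al x (str_bracket al y z) = x 0 (inord 5) *:
    (y 0 (inord 5) *: D (D z) - z 0 (inord 5) *: D (D y)).
  rewrite BE str_bracketE inordK // al5 mulmx0 mul0mx mxE oppr0 scale0r subr0.
  by rewrite BE /D linearBr !linearZr_LR.
split=> [x | x y z]; first by rewrite BE subrr.
rewrite !BB; move: (D (D x)) (D (D y)) (D (D z)) (x _ _) (y _ _) (z _ _).
by clear=> u v w a b c; apply/rowP=> i; rewrite !mxE; ring.
Qed.

(* [k11 p], [k13], [k15], [k23], [k25] below are respectively
   $k_{11}^{p,0,0,1}$, $k_{13}$, $k_{15}^0$, $k_{23}^0$, $k_{25}^{0,0,1}$. *)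
Definition eqs_k11 (p : F) : seq 'M[F]_6 :=
  [:: p *: f2 1 6; f2 3 6; - f2 2 6; f2 5 6; - f2 4 6; 0].
Definition eqs_k13 : seq 'M[F]_6 := [:: f2 1 6; 0; 0; 0; 0; 0].
Definition eqs_k15 : seq 'M[F]_6 := [:: f2 2 6; - f2 1 6; 0; 0; 0; 0].
Definition eqs_k23 : seq 'M[F]_6 := [:: f2 2 6; - f2 1 6; f2 4 6; 0; 0; 0].
Definition eqs_k25 : seq 'M[F]_6 :=
  [:: f2 2 6; - f2 1 6; f2 4 6; - f2 3 6; 0; 0].

Fact struct_eq1 j : exists (c : F) i, f2 j 6 = c *: f2 i 6.
Proof. by exists 1, j; rewrite scale1r. Qed.
Fact struct_eqN j : exists (c : F) i, - f2 j 6 = c *: f2 i 6.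
Proof. by exists (-1), j; rewrite scaleN1r. Qed.
Fact struct_eqZ a j : exists (c : F) i, a *: f2 j 6 = c *: f2 i 6.
Proof. by exists a, j. Qed.
Fact struct_eq0 : exists (c : F) i, 0 = c *: f2 i 6.
Proof. by exists 0, 1%N; rewrite scale0r. Qed.

Local Ltac lie_eqs :=
  apply: lie_equations_f6;
  [ case=> [[|[|[|[|[|[|?]]]]]] ?]; [ .. | done ]; cbn [nat_of_ord nth];
    solve [ simple apply struct_eqZ | simple apply struct_eqN
          | simple apply struct_eq1 | simple apply struct_eq0 ]
  | reflexivity ].

Fact lie_k11 p : lie_equations (eqs_k11 p). Proof. rewrite /eqs_k11; lie_eqs. Qed.
Fact lie_k13 : lie_equations eqs_k13. Proof. rewrite /eqs_k13; lie_eqs. Qed.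
Fact lie_k15 : lie_equations eqs_k15. Proof. rewrite /eqs_k15; lie_eqs. Qed.
Fact lie_k23 : lie_equations eqs_k23. Proof. rewrite /eqs_k23; lie_eqs. Qed.
Fact lie_k25 : lie_equations eqs_k25. Proof. rewrite /eqs_k25; lie_eqs. Qed.

Definition k11 p := lie_of_equations (lie_k11 p).
Definition k13 := lie_of_equations lie_k13.
Definition k15 := lie_of_equations lie_k15.
Definition k23 := lie_of_equations lie_k23.
Definition k25 := lie_of_equations lie_k25.
End StructureEquations.

(** * Complexification *)

(* [(x, y)] stands for [x + i y] in $V \otimes \mathbb{C}$. *)
Definition complexification (R : rcfType) (V : lmodType R) : Type := (V * V)%type.

Section Complexification.
Variables (R : rcfType) (V : lmodType R).
Local Notation W := (complexification V).

HB.instance Definition _ := GRing.Zmodule.on W.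

Definition cscale (c : R[i]) (z : W) : W :=
  (complex.Re c *: z.1 - complex.Im c *: z.2, complex.Re c *: z.2 + complex.Im c *: z.1).

Fact cscaleA a b z : cscale a (cscale b z) = cscale (a * b) z.
Proof.
case: a b z => [a1 a2] [b1 b2] [x y]; rewrite /cscale /=.
congr pair; rewrite !(scalerBl, scalerDl, scalerBr, scalerDr) !scalerA.
  by rewrite !opprD [- _ - _ in LHS]addrC addrACA.
by rewrite [in X in _ + X = _]addrC addrACA.
Qed.
Fact cscale1 : left_id 1 cscale.
Proof. by case=> x y; rewrite /cscale /= !scale1r !scale0r subr0 addr0. Qed.
Fact cscaleDr : right_distributive cscale +%R.
Proof.
move=> [a b] [x y] [x' y']; rewrite /cscale /=.
by congr pair => /=; rewrite !scalerDr ?opprD addrACA.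
Qed.
Fact cscaleDl z : {morph cscale^~ z : a b / a + b}.
Proof.
move=> [a b] [a' b']; rewrite /cscale /=.
by congr pair => /=; rewrite !scalerDl ?opprD addrACA.
Qed.
HB.instance Definition _ :=
  GRing.Zmodule_isLmodule.Build R[i] W cscaleA cscale1 cscaleDr cscaleDl.

(* Complex-linear extension of an endomorphism, and complex-bilinear extensions
   of a bilinear product and of a bilinear form. *)
Definition cext (f : V -> V) (z : W) : W := (f z.1, f z.2).

Definition cext_prod (b : V -> V -> V) (z w : W) : W :=
  (b z.1 w.1 - b z.2 w.2, b z.1 w.2 + b z.2 w.1).

Definition cext_form (b : V -> V -> R) (z w : W) : R[i] :=
  (b z.1 w.1 - b z.2 w.2) +i* (b z.1 w.2 + b z.2 w.1).
End Complexification.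

(** * Alternating forms and multivectors *)

Section Multivectors.
Variables (C : fieldType) (W : lmodType C).

Definition tset k (t : k.-tuple W) (i : 'I_k) (w : W) : k.-tuple W :=
  [tuple if j == i then w else tnth t j | j < k].

Definition multilinear k (al : k.-tuple W -> C) : Prop :=
  forall (t : k.-tuple W) (i : 'I_k) (a : C) (u v : W),
    al (tset t i (a *: u + v)) = a * al (tset t i u) + al (tset t i v).

Definition alternating k (al : k.-tuple W -> C) : Prop :=
  forall (t : k.-tuple W) (i j : 'I_k),
    i != j -> tnth t i = tnth t j -> al t = 0.

(* An element of $\Lambda^k W$ is represented by a finite sum of decomposable
   multivectors, the sequence [:: t; ...] standing for the sum of the
   $t_1 \wedge \dots \wedge t_k$. By the universal property of $\Lambda^k W$,
   two sums are equal iff no alternating [k]-linear form separates them. *)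
Definition multivector k := seq (k.-tuple W).

Definition mv_zero k (s : multivector k) : Prop :=
  forall al : k.-tuple W -> C,
    multilinear al -> alternating al -> \sum_(t <- s) al t = 0.
End Multivectors.

(** * Hermitian and holomorphic Poisson structures *)

Section Hermitian.
Variables (R : rcfType) (g : lieAlgebra R).
Local Notation C := R[i].
Local Notation gC := (complexification g).

Definition cbracket : gC -> gC -> gC := cext_prod bracket.

Definition nijenhuis (J : 'End(g)) (x y : g) : g :=
  bracket (J x) (J y) - J (bracket (J x) y) - J (bracket x (J y)) - bracket x y.

Definition is_complex_structure (J : 'End(g)) : Prop :=
  (forall x, J (J x) = - x) /\ (forall x y, nijenhuis J x y = 0).

Definition is_hermitian (J : 'End(g)) (m : {dot g for idfun}) : Prop :=
  is_complex_structure J /\ (forall x y, m (J x) (J y) = m x y).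

Variable J : 'End(g).

Definition in10 (z : gC) : Prop := cext J z = 'i%C *: z.
Definition in01 (z : gC) : Prop := cext J z = (- 'i%C) *: z.

(* The components of $z$ in $g^{1,0} \oplus g^{0,1}$. *)
Definition proj10 (z : gC) : gC := 2^-1 *: (z - 'i%C *: cext J z).
Definition proj01 (z : gC) : gC := 2^-1 *: (z + 'i%C *: cext J z).

Definition cform k := k.-tuple gC -> C.

(* Chevalley-Eilenberg differential: the pair of positions $i < j'$ is
   written [(i, lift i j)] with [i <= j], so that [j' = j.+1]. *)
Definition ce_diff k (al : cform k.+1) : cform k.+2 := fun t =>
  \sum_(i < k.+2) \sum_(j < k.+1 | (i <= j)%N)
    (-1) ^+ (i + j.+1) *
    al [tuple of cbracket (tnth t i) (tnth t (lift i j))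
          :: [tuple tnth t (lift i (lift j l)) | l < k]].

(* The component of bidegree $(p, k - p)$. *)
Definition bidegree_part k (p : nat) (al : cform k) : cform k := fun t =>
  \sum_(S : {set 'I_k} | #|S| == p)
    al [tuple if i \in S then proj10 (tnth t i) else proj01 (tnth t i) | i < k].

Definition del k (al : cform k.+1) : cform k.+2 := fun t =>
  \sum_(p < k.+2) bidegree_part p.+1 (ce_diff (bidegree_part p al)) t.

Definition delbar k (al : cform k.+1) : cform k.+2 := fun t =>
  \sum_(p < k.+2) bidegree_part p (ce_diff (bidegree_part p al)) t.

Definition fundamental_form (m : {dot g for idfun}) : cform 2 := fun t =>
  cext_form (fun x y => m (J x) y) (tnth t ord0) (tnth t ord_max).

Definition is_SKT (m : {dot g for idfun}) : Prop :=
  is_hermitian J m /\ forall t, del (delbar (fundamental_form m)) t = 0.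

(* For [x] in $g^{0,1}$, the operator $\overline\partial_x$ on bivectors, given
   by the Leibniz rule on each decomposable summand. *)
Definition dbar (x y : gC) : gC := proj10 (cbracket x y).

Definition dbar_bivector (x : gC) (pi : multivector gC 2) : multivector gC 2 :=
  flatten [seq [:: [tuple dbar x (tnth t ord0); tnth t ord_max];
                   [tuple tnth t ord0; dbar x (tnth t ord_max)]] | t <- pi].

(* The Schouten bracket of two decomposable bivectors; [ordS] is the successor
   modulo 2 on ['I_2], and the sign is put on the first factor. *)
Definition schouten_wedge (u v : 2.-tuple gC) : multivector gC 3 :=
  [seq [tuple (-1) ^+ (nat_of_ord j + nat_of_ord k)
                *: cbracket (tnth u j) (tnth v k);
              tnth u (ordS j); tnth v (ordS k)]
     | j <- enum 'I_2, k <- enum 'I_2].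

Definition schouten (s t : multivector gC 2) : multivector gC 3 :=
  flatten [seq schouten_wedge u v | u <- s, v <- t].

Definition is_holomorphic_poisson (pi : multivector gC 2) : Prop :=
  [/\ forall t i, t \in pi -> in10 (tnth t i),
      forall x, in01 x -> mv_zero (dbar_bivector x pi)
    & mv_zero (schouten pi pi)].
End Hermitian.

(* Left-invariant structures on the simply connected Lie group with Lie algebra
   [g] are the corresponding structures on [g]. *)
Definition admits_SKT_with_holomorphic_poisson
    (R : rcfType) (g : lieAlgebra R) : Prop :=
  exists (J : 'End(g)) (m : {dot g for idfun}),
    is_SKT J m /\
    exists pi : multivector (complexification g) 2,
      is_holomorphic_poisson J pi /\ ~ mv_zero pi.

(* Main.v *)
Require Import Defs.
From HB Require Import structures.
From mathcomp Require Import all_boot all_order all_algebra reals.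
From mathcomp Require Import ring lra.
From mathcomp Require Import boolp.

(** Let [n] be a unit normal of an abelian ideal [A] of codimension one, and let
    [D = ad n]. Then [J n] lies in [A], and [A] is the orthogonal sum of the line of
    [J n] and of the complex core [A1 = A `&` J A], of real dimension four.
    Integrability of [J] says that [D] preserves [A1] and is complex linear
    there, so the structure is described by a number [a], a vector [v] of [A1] with
    [D (J n) = a J n + v], and a complex endomorphism [B] of the hermitian plane [A1].

    On [T = n - i J n], [X], the conjugate of [T] and the conjugate of [Y], with [X]
    and [Y] of type (1,0) over [A1], the form [del (delbar omega)] becomes, up to a
    constant, the bilinear form of [B^2 + (B^t)^2 + 2 B^t B + a (B + B^t)]
    ([SKT_identity]). In a unitary basis that makes [B] triangular, the vanishing of
    this form kills the off-diagonal entry and forces the real part of each eigenvalue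
    [l1], [l2] of [B] to be [0] or [- a / 2] ([SKT_diagonal]).

    The operators dbar on vectors of type (1,0) come from a single one, along the
    conjugate of [T], which is triangular with eigenvalues [a], [l1], [l2]. On
    bivectors its eigenvalues are therefore [a + l1], [a + l2] and [l1 + l2], and a
    nonzero holomorphic bivector needs one of them to vanish ([Poisson_eigenvalues]).
    Together with the restriction on the real parts, this leaves [l1 = i b1] and
    [l2 = i b2] with either [b1 + b2 = 0], or [a = 0] and one of [b1], [b2] zero.
    Adding a vector of [A1] to [J n] removes the part of [v] in every eigenline whose
    eigenvalue differs from [a]; after rescaling, and since [g] is not nilpotent, five
    normal forms remain ([admits_normal_form]), one for each algebra of the list.

    Conversely, in a normal form [B] is skew for the metric that makes the basis
    orthonormal. Then [d omega] is [- c] times the wedge of the area form of the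
    plane of [n], [J n] with a 1-form, and [delbar omega] is closed ([nf_SKT]).
    The bivector on the two eigenvectors over [A1] when [b1 + b2 = 0], and the one on
    [T] and the eigenvector over the kernel when [a = b1 = 0], is holomorphic; its
    Schouten square vanishes because its factors commute ([normal_form_admits]).

    Finally [ad n] has trace [a] in a normal form, so unimodularity leaves the three
    normal forms with [a = 0]; each of these has a central vector outside a
    hyperplane that contains the derived algebra, hence a one-dimensional direct
    summand ([central_summand]). *)

Set Implicit Arguments.
Unset Strict Implicit.
Unset Printing Implicit Defensive.

Import Order.TTheory GRing.Theory Num.Theory.
Local Open Scope ring_scope.
Local Open Scope complex_scope.

(** * Linear and bilinear expansion *)

(** Reduces an identity between linear combinations of vectors to an identity
    between scalars, where the tactics for rings and fields apply. The test function
    comes with its linearity as hypotheses on a bare function, so that rewriting with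
    them never looks for linear structures inside the vectors. *)
Lemma scalar_ext (F : fieldType) (V : vectType F) (u v : V) :
  (forall phi : V -> F,
     (forall x y, phi (x + y) = phi x + phi y) ->
     (forall x, phi (- x) = - phi x) ->
     (forall a x, phi (a *: x) = a * phi x) -> phi 0 = 0 -> phi u = phi v) ->
  u = v.
Proof.
move=> uv; rewrite (coord_vbasis (memvf u)) (coord_vbasis (memvf v)).
apply: eq_bigr => i _; congr (_ *: _).
apply: (uv (coord (vbasis fullv) i)) => [x y|x|a x|].
- exact: linearD.
- exact: linearN.
- exact: linearZ.
- exact: linear0.
Qed.

Ltac to_scalars :=
  let phi := fresh "phi" in let phiD := fresh "phiD" in
  let phiN := fresh "phiN" in let phiZ := fresh "phiZ" in
  let phi0 := fresh "phi0" in
  apply: scalar_ext => phi phiD phiN phiZ phi0;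
  rewrite ?(phiD, phiN, phiZ, phi0).
Ltac mod_ring := to_scalars; ring.
Ltac mod_field := to_scalars; field; try by [].

Lemma lfun_simp (F : fieldType) (V W : vectType F) (f : 'Hom(V, W)) :
  (forall x y, f (x + y) = f x + f y) * (forall x, f (- x) = - f x) *
  (forall a x, f (a *: x) = a *: f x) * (f 0 = 0).
Proof. by split; [split; [split|]|]; move=> *; rewrite (linearD, linearN, linearZ_LR, linear0). Qed.

Lemma bracket_simp (F : fieldType) (g : lieAlgebra F) :
  (forall x y z : g, bracket (x + y) z = bracket x z + bracket y z) *
  (forall x y z : g, bracket x (y + z) = bracket x y + bracket x z) *
  (forall x y : g, bracket (- x) y = - bracket x y) *
  (forall x y : g, bracket x (- y) = - bracket x y) *
  (forall a (x y : g), bracket (a *: x) y = a *: bracket x y) *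
  (forall a (x y : g), bracket x (a *: y) = a *: bracket x y) *
  (forall y : g, bracket 0 y = 0) * (forall y : g, bracket y 0 = 0).
Proof.
split; last by move=> *; rewrite linear0r.
split; last by move=> *; rewrite linear0l.
split; last by move=> *; rewrite linearZr_LR.
split; last by move=> *; rewrite linearZl_LR.
split; last by move=> *; rewrite linearNr.
split; last by move=> *; rewrite linearNl.
by split; move=> *; rewrite (linearDl,linearDr).
Qed.

Lemma dot_simp (R : numDomainType) (V : lmodType R) (m : {dot V for idfun}) :
  (forall x y z, m (x + y) z = m x z + m y z) *
  (forall x y z, m x (y + z) = m x y + m x z) *
  (forall x y, m (- x) y = - m x y) *
  (forall x y, m x (- y) = - m x y) *
  (forall a x y, m (a *: x) y = a * m x y) *
  (forall a x y, m x (a *: y) = a * m x y) *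
  (forall y, m 0 y = 0) * (forall y, m y 0 = 0).
Proof.
split; last by move=> *; rewrite linear0r.
split; last by move=> *; rewrite linear0l.
split; last by move=> *; rewrite linearZr_LR.
split; last by move=> *; rewrite linearZl_LR.
split; last by move=> *; rewrite linearNr.
split; last by move=> *; rewrite linearNl.
by split; move=> *; rewrite (linearDl,linearDr).
Qed.

Lemma dotC (R : numDomainType) (V : lmodType R) (m : {dot V for idfun}) x y :
  m x y = m y x.
Proof. by rewrite hermC expr0 mul1r. Qed.

(** * Vectors of type (1,0) and (0,1) *)

Section Types.
Variables (R : rcfType) (g : lieAlgebra R) (J : 'End(g)).
Hypothesis J2 : forall x, J (J x) = - x.
Local Notation gC := (complexification g).

Lemma cscaleE (c : R[i]) (z : gC) : c *: z =
  (complex.Re c *: z.1 - complex.Im c *: z.2, complex.Re c *: z.2 + complex.Im c *: z.1).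
Proof. by []. Qed.

(** [x - i J x], the vector of type (1,0) above [x]. It identifies [(g, J)], as a
    complex vector space, with the (1,0)-part of the complexification. *)
Definition iota10 (x : g) : gC := (x, - J x).
Definition iota01 (x : g) : gC := (x, J x).

Lemma proj10E (z : gC) : proj10 J z = iota10 (2^-1 *: (z.1 + J z.2)).
Proof.
rewrite /proj10 !cscaleE /iota10 /=.
congr (_, _); first by mod_field.
by rewrite !lfun_simp J2; mod_field.
Qed.

Lemma proj01E (z : gC) : proj01 J z = iota01 (2^-1 *: (z.1 - J z.2)).
Proof.
rewrite /proj01 !cscaleE /iota01 /=.
congr (_, _); first by mod_field.
by rewrite !lfun_simp J2; mod_field.
Qed.

Lemma in10P (z : gC) : in10 J z <-> z = iota10 z.1.
Proof.
case: z => x y; rewrite /in10 /cext cscaleE /iota10 /=.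
split=> [[-> _]|[->]]; congr (_, _); rewrite ?lfun_simp ?J2; mod_ring.
Qed.

Lemma in01P (z : gC) : in01 J z <-> z = iota01 z.1.
Proof.
case: z => x y; rewrite /in01 /cext cscaleE /iota01 /=.
split=> [[-> _]|[->]]; congr (_, _); rewrite ?lfun_simp ?J2; mod_ring.
Qed.

Lemma in10_iota x : in10 J (iota10 x). Proof. exact/in10P. Qed.
Lemma in01_iota x : in01 J (iota01 x). Proof. exact/in01P. Qed.

Lemma proj10_iota10 x : proj10 J (iota10 x) = iota10 x.
Proof. by rewrite proj10E; congr iota10; rewrite /iota10 /= lfun_simp J2; mod_field. Qed.
Lemma proj01_iota01 x : proj01 J (iota01 x) = iota01 x.
Proof. by rewrite proj01E; congr iota01; rewrite /iota01 /= J2; mod_field. Qed.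
Lemma iota10_0 : iota10 0 = 0.
Proof. by rewrite /iota10 lfun_simp oppr0. Qed.
Lemma iota01_0 : iota01 0 = 0.
Proof. by rewrite /iota01 lfun_simp. Qed.
Lemma proj10_iota01 x : proj10 J (iota01 x) = 0.
Proof. by rewrite proj10E {1 2}/iota01 /= J2 subrr scaler0 iota10_0. Qed.
Lemma proj01_iota10 x : proj01 J (iota10 x) = 0.
Proof. by rewrite proj01E {1 2}/iota10 /= lfun_simp J2 opprK subrr scaler0 iota01_0. Qed.

Lemma proj_split (z : gC) : z = proj10 J z + proj01 J z.
Proof.
case: z => x y; rewrite proj10E proj01E /iota10 /iota01.
by apply: injective_projections => /=; rewrite ?lfun_simp ?J2; mod_field.
Qed.

(** * The bigrading of forms *)

(** The part of multilinearity on which the bigrading rests: it discards the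
    terms in which a projection kills an entry, and it passes to differentials and to
    bidegree parts. *)
Definition zero_entry k (al : cform g k) :=
  forall t i, tnth t i = 0 -> al t = 0.

Definition proj_on k (S : {set 'I_k}) (t : k.-tuple gC) : k.-tuple gC :=
  [tuple if i \in S then proj10 J (tnth t i) else proj01 J (tnth t i) | i < k].

Definition homogeneous k (S : {set 'I_k}) (t : k.-tuple gC) :=
  forall i, if i \in S then in10 J (tnth t i) else in01 J (tnth t i).

Lemma homogeneous_proj_on k (S : {set 'I_k}) t : homogeneous S (proj_on S t).
Proof.
move=> i; rewrite tnth_mktuple; case: (i \in S).
  by rewrite proj10E; apply: in10_iota.
by rewrite proj01E; apply: in01_iota.
Qed.

(** Of all the sets of positions on which one may project, only the actual type
    of [t] keeps every entry nonzero. *)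
Lemma bidegree_homogeneous k p (al : cform g k) (S : {set 'I_k}) t :
    zero_entry al -> homogeneous S t ->
  bidegree_part J p al t = if #|S| == p then al t else 0.
Proof.
move=> al0 tS; have other S' : S' != S -> al (proj_on S' t) = 0.
  move=> S'S; have /existsP[i iS] : [exists i, (i \in S') != (i \in S)].
    apply: contraNT S'S => /existsPn nS; apply/eqP/setP => i.
    by have := nS i; rewrite negbK => /eqP.
  apply: (al0 _ i); rewrite tnth_mktuple; move: (tS i) iS.
  case: (i \in S') (i \in S) => [] [] //.
    by move=> /in01P -> _; rewrite proj10_iota01.
  by move=> /in10P -> _; rewrite proj01_iota10.
have same : proj_on S t = t.
  apply: eq_from_tnth => i; rewrite tnth_mktuple; have := tS i.
  by case: (i \in S) => [/in10P|/in01P] ->;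
    rewrite (proj10_iota10, proj01_iota01).
rewrite -[LHS]/(\sum_(S' : {set 'I_k} | #|S'| == p) al (proj_on S' t)).
case: eqP => [Sp|/eqP Sp].
  rewrite (bigD1 S) ?Sp //= big1 ?addr0 ?same // => S' /andP[_].
  exact: other.
rewrite big1 // => S' /eqP S'p; apply: other.
by apply: contraNneq Sp => <-; apply/eqP.
Qed.

Lemma bidegree_comp k p q (al : cform g k) : zero_entry al ->
  bidegree_part J p (bidegree_part J q al) =
  if p == q then bidegree_part J p al else fun=> 0.
Proof.
move=> al0; apply: funext => t.
rewrite -[LHS]/(\sum_(S : {set 'I_k} | #|S| == p) bidegree_part J q al (proj_on S t)).
rewrite (eq_bigr (fun S => if p == q then al (proj_on S t) else 0)); last first.
  move=> S /eqP Sp; rewrite (bidegree_homogeneous q al0 (@homogeneous_proj_on _ S t)).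
  by rewrite Sp.
by case: (p == q) => //; apply: big1.
Qed.

Lemma bidegree1 k (al : cform g k) t :
  bidegree_part J 1 al t = \sum_(i < k) al (proj_on [set i] t).
Proof.
rewrite -[LHS]/(\sum_(S : {set 'I_k} | #|S| == 1%N) al (proj_on S t)).
by rewrite big_cards1.
Qed.

Lemma bidegree1_2 (al : cform g 2) x y :
  bidegree_part J 1 al [tuple x; y] =
  al [tuple proj10 J x; proj01 J y] + al [tuple proj01 J x; proj10 J y].
Proof.
rewrite bidegree1 !big_ord_recl big_ord0 addr0.
by congr (al _ + al _); apply: val_inj; rewrite /= !enum_ordSl enum_ord0 /= !inE.
Qed.

Lemma bidegree1_3 (al : cform g 3) x y z :
  bidegree_part J 1 al [tuple x; y; z] =
  al [tuple proj10 J x; proj01 J y; proj01 J z]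
  + al [tuple proj01 J x; proj10 J y; proj01 J z]
  + al [tuple proj01 J x; proj01 J y; proj10 J z].
Proof.
rewrite bidegree1 !big_ord_recl big_ord0 addr0 addrA.
by congr (al _ + al _ + al _); apply: val_inj;
  rewrite /= !enum_ordSl enum_ord0 /= !inE.
Qed.

Lemma ce_diff2 (al : cform g 2) x y z :
  ce_diff al [tuple x; y; z] =
  - al [tuple cbracket x y; z] + al [tuple cbracket x z; y]
  - al [tuple cbracket y z; x].
Proof.
rewrite /ce_diff.
under eq_bigr => i _ do rewrite big_mkcond /= !big_ord_recl big_ord0 addr0 /=.
rewrite !big_ord_recl big_ord0 /= !addr0 !add0r.
rewrite -![(-1) ^+ (_ + _)]signr_odd /= !expr1 !expr0 !mulN1r !mul1r -!addrA.
congr (- al _ + (al _ - al _));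
  by apply: val_inj; rewrite /= !enum_ordSl enum_ord0.
Qed.

Lemma ce_diff3 (al : cform g 3) x y z w :
  ce_diff al [tuple x; y; z; w] =
  - al [tuple cbracket x y; z; w] + al [tuple cbracket x z; y; w]
  - al [tuple cbracket x w; y; z] - al [tuple cbracket y z; x; w]
  + al [tuple cbracket y w; x; z] - al [tuple cbracket z w; x; y].
Proof.
rewrite /ce_diff.
under eq_bigr => i _ do rewrite big_mkcond /= !big_ord_recl big_ord0 addr0 /=.
rewrite !big_ord_recl big_ord0 /= !addr0 !add0r.
rewrite -![(-1) ^+ (_ + _)]signr_odd /= !expr1 !expr0 !mulN1r !mul1r -!addrA.
congr (- al _ + (al _ + (- al _ + (- al _ + (al _ - al _)))));
  by apply: val_inj; rewrite /= !enum_ordSl enum_ord0.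
Qed.

Lemma cbracket0l (x : gC) : cbracket 0 x = 0.
Proof. by rewrite /cbracket /cext_prod /= !bracket_simp subrr addr0. Qed.

Lemma cbracket0r (x : gC) : cbracket x 0 = 0.
Proof. by rewrite /cbracket /cext_prod /= !bracket_simp subrr addr0. Qed.

Lemma tuple2E (T : Type) (t : 2.-tuple T) : t = [tuple tnth t ord0; tnth t ord_max].
Proof.
by apply: eq_from_tnth => i; case: i => [[|[|//]]] ?;
  rewrite /tnth /=; apply: set_nth_default; rewrite size_tuple.
Qed.

Lemma ce_diff2_zero_entry (al : cform g 2) :
  zero_entry al -> zero_entry (ce_diff al).
Proof.
move=> al0 t i.
case/tupleP: t => x t; case/tupleP: t => y t; case/tupleP: t => z t.
rewrite (tuple0 t) => ti0.
have a1 u v : u = 0 -> al [tuple u; v] = 0 by move=> ->; apply: (al0 _ ord0).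
have a2 u v : v = 0 -> al [tuple u; v] = 0 by move=> ->; apply: (al0 _ ord_max).
rewrite ce_diff2.
case: i ti0 => [[|[|[|//]]] ?]; rewrite /tnth /= => ->;
  rewrite ?cbracket0l ?cbracket0r.
- by rewrite (a1 0) // (a1 0) // (a2 _ 0) // !oppr0 !addr0.
- by rewrite (a1 0) // (a1 0) // (a2 _ 0) // !oppr0 !addr0.
- by rewrite (a1 0) // (a1 0) // (a2 _ 0) // !oppr0 !addr0.
Qed.

Lemma ce_diff3_zero_entry (al : cform g 3) :
  zero_entry al -> zero_entry (ce_diff al).
Proof.
move=> al0 t i.
case/tupleP: t => x t; case/tupleP: t => y t; case/tupleP: t => z t.
case/tupleP: t => w t.
rewrite (tuple0 t) => ti0.
have a1 v w' : al [tuple 0; v; w'] = 0 by apply: (al0 _ ord0).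
have a2 u w' : al [tuple u; 0; w'] = 0 by apply: (al0 _ (lift ord0 ord0)).
have a3 u v : al [tuple u; v; 0] = 0 by apply: (al0 _ ord_max).
rewrite ce_diff3.
case: i ti0 => [[|[|[|[|//]]]] ?]; rewrite /tnth /= => ->;
  rewrite ?cbracket0l ?cbracket0r ?a1 ?a2 ?a3 !oppr0 !addr0 //.
Qed.

Lemma bidegree_zero_entry k p (al : cform g k) :
  zero_entry al -> zero_entry (bidegree_part J p al).
Proof.
move=> al0 t i ti; apply: big1 => S _; apply: (al0 _ i).
have cJ0 : cext J (0 : gC) = 0 by rewrite /cext /= !lfun_simp.
rewrite tnth_mktuple ti.
by rewrite /proj10 /proj01 cJ0 scaler0 subr0 addr0 scaler0; case: ifP.
Qed.

Lemma ce_diff0 k : ce_diff (fun=> 0 : R[i]) = (fun=> 0) :> cform g k.+2.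
Proof.
by apply: funext => t; rewrite /ce_diff big1 // => i _; rewrite big1 // => j _; rewrite mulr0.
Qed.

Lemma bidegree0 k p : bidegree_part J p (fun=> 0) = (fun=> 0) :> cform g k.
Proof. by apply: funext => t; rewrite /bidegree_part big1. Qed.

(** For [om] of type (1,1) only one bidegree survives at each stage, which
    collapses the sums over bidegrees in [del] and [delbar]. *)
Lemma del_delbar_11 (om : cform g 2) :
    zero_entry om ->
    (forall p, bidegree_part J p om = if p == 1%N then om else fun=> 0) ->
  del J (delbar J om) =
  bidegree_part J 2 (ce_diff (bidegree_part J 1 (ce_diff om))).
Proof.
move=> fundamental0 om11; have d_fundamental0 := ce_diff2_zero_entry fundamental0.
have delbarE : delbar J om = bidegree_part J 1 (ce_diff om).
  apply: funext => t; rewrite /delbar !big_ord_recl big_ord0 !om11 /=.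
  by rewrite !ce_diff0 !bidegree0 add0r !addr0.
apply: funext => t; rewrite delbarE /del !big_ord_recl big_ord0.
by rewrite !bidegree_comp //= !ce_diff0 !bidegree0 add0r !addr0.
Qed.

End Types.

(** * The fundamental form *)

Section Hermitian.
Variables (R : rcfType) (g : lieAlgebra R) (J : 'End(g)) (m : {dot g for idfun}).
Hypothesis J2 : forall x, J (J x) = - x.
Hypothesis mJJ : forall x y, m (J x) (J y) = m x y.
Local Notation gC := (complexification g).
Local Notation om := (fundamental_form J m).

Lemma fundamental_formE (x y : gC) : om [tuple x; y] =
  (m (J x.1) y.1 - m (J x.2) y.2) +i* (m (J x.1) y.2 + m (J x.2) y.1).
Proof. by []. Qed.

Lemma dot_Jr x y : m x (J y) = - m (J x) y.
Proof. by rewrite -mJJ J2 dot_simp. Qed.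

Lemma fundamental_zero_entry : zero_entry om.
Proof.
move=> t i; rewrite (tuple2E t) => ti.
rewrite fundamental_formE; case: i ti => [[|[|//]]] ? ; rewrite {1}/tnth /= => ->;
 by rewrite /= ?lfun_simp !dot_simp subrr addr0.
Qed.

Lemma fundamentalDl x y z :
  om [tuple x + y; z] = om [tuple x; z] + om [tuple y; z].
Proof.
by rewrite !fundamental_formE /= !lfun_simp !dot_simp; congr (_ +i* _); ring.
Qed.

Lemma fundamentalDr x y z :
  om [tuple z; x + y] = om [tuple z; x] + om [tuple z; y].
Proof.
by rewrite !fundamental_formE /= !dot_simp; congr (_ +i* _); ring.
Qed.

Lemma fundamental_10 x y : om [tuple iota10 J x; iota10 J y] = 0.
Proof.
rewrite fundamental_formE /= !lfun_simp J2 !dot_simp mJJ dot_Jr.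
by congr (_ +i* _); ring.
Qed.

Lemma fundamental_01 x y : om [tuple iota01 J x; iota01 J y] = 0.
Proof.
rewrite fundamental_formE /= J2 !dot_simp mJJ dot_Jr.
by congr (_ +i* _); ring.
Qed.

(** The two vanishing lemmas above say that the fundamental form has type (1,1):
    it vanishes on two vectors of the same type because [J] is an isometry. *)
Lemma fundamental_11 p :
  bidegree_part J p om = if p == 1%N then om else fun=> 0.
Proof.
apply: funext => t; case: eqP => [->|/eqP p1].
  rewrite (tuple2E t); move: (tnth _ _) (tnth _ _) => x y; rewrite bidegree1_2.
  rewrite [x in RHS](proj_split J2) [y in RHS](proj_split J2).
  rewrite fundamentalDl !fundamentalDr !(proj10E J2) !(proj01E J2).
  by rewrite fundamental_10 fundamental_01 add0r addr0.
rewrite /bidegree_part big1 // => S /eqP Sp.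
have [E|[E|E]] : S = set0 \/ S = setT \/ #|S| = 1%N.
  have := max_card (mem S); rewrite card_ord => S2.
  case E : #|S| => [|[|[|?]]].
  - by left; apply: cards0_eq.
  - by right; right.
  - by right; left; apply/eqP; rewrite eqEcard subsetT cardsT card_ord E.
  - by rewrite E in S2.
- rewrite E (tuple2E t).
  apply: etrans (fundamental_01 (2^-1 *: ((tnth t ord0).1 - J (tnth t ord0).2)) (2^-1 *: ((tnth t ord_max).1 - J (tnth t ord_max).2))).
  rewrite -!(proj01E J2); congr om; apply: val_inj.
  by rewrite /= !enum_ordSl enum_ord0 /= !inE.
- rewrite E (tuple2E t).
  apply: etrans (fundamental_10 (2^-1 *: ((tnth t ord0).1 + J (tnth t ord0).2)) (2^-1 *: ((tnth t ord_max).1 + J (tnth t ord_max).2))).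
  rewrite -!(proj10E J2); congr om; apply: val_inj.
  by rewrite /= !enum_ordSl enum_ord0 /= !inE.
- by move: p1; rewrite -Sp E.
Qed.

Lemma del_delbar_fundamental :
  del J (delbar J om) =
  bidegree_part J 2 (ce_diff (bidegree_part J 1 (ce_diff om))).
Proof.
by apply: del_delbar_11 => //; [exact: fundamental_zero_entry|exact: fundamental_11].
Qed.

End Hermitian.
Arguments bidegree_zero_entry {R g} J {k} p {al} _ [t i].

(** * Unit normal of the abelian ideal *)

Lemma bracketC (F : fieldType) (g : lieAlgebra F) (x y : g) :
  bracket x y = - bracket y x.
Proof.
have := bracket_alternating (x + y).
rewrite !bracket_simp !bracket_alternating add0r addr0 => /eqP.
by rewrite addr_eq0 => /eqP.
Qed.

Lemma unit_multiple (R : rcfType) (V : lmodType R) (m : {dot V for idfun}) v :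
  v != 0 -> exists c, m (c *: v) (c *: v) = 1.
Proof.
move=> v0; have N0 : 0 < m v v by apply: neq0_dnorm_gt0.
exists (Num.sqrt (m v v))^-1.
rewrite !dot_simp mulrA -expr2 exprVn sqr_sqrtr ?ltW ?N0 // mulVf //.
by rewrite gt_eqF.
Qed.

Lemma unit_orthogonal (R : rcfType) (g : vectType R) (m : {dot g for idfun})
    (s : seq g) : (size s < \dim {:g})%N ->
  exists2 u : g, m u u = 1 & forall x, x \in s -> m x u = 0.
Proof.
move=> s_small; have [V Vs dimV] : exists2 V : {vspace g},
    forall u x, u \in V -> x \in s -> m x u = 0 & (\dim {:g} - size s <= \dim V)%N.
  elim: s {s_small} => [|x s [V Vs dimV]]; first by exists fullv; rewrite ?subn0.
  exists (V :&: orthov m <[x]>)%VS => [u y|].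
    rewrite memv_cap in_cons mem_orthov1 => /andP[uV /eqP ux].
    by case/predU1P=> [->|]; [rewrite dotC|exact: Vs].
  apply: leq_trans (leq_dim_orthov1 m x V).
  by rewrite /= subnS -!subn1 leq_sub2r.
have : V != 0%VS by rewrite -dimv_eq0 -lt0n (leq_trans _ dimV) ?subn_gt0.
move=> V0; have v0 : vpick V != 0 by rewrite vpick0.
have [c c1] := unit_multiple m v0; exists (c *: vpick V) => // x xs.
by rewrite dot_simp (Vs _ _ (memv_pick V) xs) mulr0.
Qed.

(** The ideal is the hyperplane orthogonal to [n], so both of its properties can
    be stated with [n] and the metric alone, and no subspace is carried along. *)
Lemma unit_normal (R : rcfType) (g : lieAlgebra R) (m : {dot g for idfun}) :
  almost_abelian g ->
  exists n : g, [/\ m n n = 1,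
    forall x y, m n x = 0 -> m n y = 0 -> bracket x y = 0
    & forall x y, m n (bracket x y) = 0].
Proof.
case=> A [dimA idA abA].
have [|n nn nA] := @unit_orthogonal R g m (vbasis A).
  by rewrite size_tuple -dimA.
have AE x : (x \in A) = (m n x == 0).
  have memn y : (y \in orthov m <[n]>) = (m n y == 0).
    by rewrite dotC; apply: mem_orthov1.
  have subA : (A <= orthov m <[n]>)%VS.
    apply/subvP => y yA; rewrite memn (coord_vbasis yA) linear_sumr /=; apply/eqP.
    rewrite big1 // => i _; rewrite dot_simp dotC nA ?mulr0 //.
    by rewrite mem_nth // size_tuple.
  have n0 : n \notin orthov m <[n]> by rewrite memn nn oner_eq0.
  have : (\dim (orthov m <[n]>) < \dim {:g})%N.
    rewrite ltn_neqAle dimvS ?subvf // andbT; apply/eqP => E.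
    by move: n0; rewrite (_ : orthov _ _ = fullv) ?memvf //; apply/eqP;
      rewrite eqEdim subvf E leqnn.
  rewrite -dimA ltnS => dimle.
  have -> : A = orthov m <[n]>.
    by apply/eqP; rewrite eqEdim subA dimle.
  by rewrite memn.
exists n; split=> // [x y nx ny|x y].
  by apply: abA; rewrite AE (nx, ny).
pose x' := x - m n x *: n; pose y' := y - m n y *: n.
have x'A : x' \in A by rewrite AE !dot_simp nn mulr1 subrr.
have y'A : y' \in A by rewrite AE !dot_simp nn mulr1 subrr.
have -> : bracket x y = bracket x y' - bracket (m n y *: n) x'.
  rewrite (bracketC _ x') /x' /y' !bracket_simp bracket_alternating; mod_ring.
by have := idA x _ y'A; have := idA (m n y *: n) _ x'A; rewrite !AE !dot_simp
  => /eqP -> /eqP ->; rewrite subrr.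
Qed.

(** * The SKT identity *)

Section Forward.
Variables (R : rcfType) (g : lieAlgebra R) (J : 'End(g)) (m : {dot g for idfun}).
Hypothesis J2 : forall x, J (J x) = - x.
Hypothesis NJ : forall x y, nijenhuis J x y = 0.
Hypothesis mJJ : forall x y, m (J x) (J y) = m x y.
Variable n : g.
Hypothesis nn : m n n = 1.
Hypothesis abA : forall x y, m n x = 0 -> m n y = 0 -> bracket x y = 0.
Hypothesis derA : forall x y, m n (bracket x y) = 0.
Local Notation gC := (complexification g).
Local Notation om := (fundamental_form J m).
Local Notation D := (bracket n).

(** [A `&` J A], where [A] is the hyperplane orthogonal to [n]: a vector lies in
    [A] and has its image by [J] in [A] iff it is orthogonal to [n] and [J n]. *)
Definition complex_core x := m n x = 0 /\ m (J n) x = 0.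

Lemma dot_n_Jn : m n (J n) = 0.
Proof. by have := dot_Jr J2 mJJ n n; rewrite dotC => ?; lra. Qed.

Lemma core_J x : complex_core x -> complex_core (J x).
Proof. by case=> nx Jx; split; rewrite ?mJJ // (dot_Jr J2 mJJ) Jx oppr0. Qed.

(** In the Nijenhuis tensor of [n] and [x] two of the four brackets are taken
    inside the abelian ideal; what remains is the commutation of [J] and [D]. *)
Lemma D_J x : complex_core x -> D (J x) = J (D x).
Proof.
move=> Ax; have [nJx _] := core_J Ax; case: Ax => nx Jx.
have := NJ n x; rewrite /nijenhuis !(abA dot_n_Jn) // lfun_simp subrr add0r => /eqP.
rewrite addr_eq0 opprK => /eqP E.
by rewrite -E lfun_simp J2 opprK.
Qed.

Lemma core_D x : complex_core x -> complex_core (D x).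
Proof.
move=> Ax; split; first exact: derA.
by have := derA n (J x); rewrite D_J // (dot_Jr J2 mJJ) => /eqP; rewrite oppr_eq0 => /eqP.
Qed.

(** [D (J n)] has no component along [n]: its component along [J n] is the weight
    and its component in the complex core is the drift. *)
Definition weight := m (J n) (D (J n)).
Definition drift := D (J n) - weight *: J n.

Lemma D_Jn : D (J n) = weight *: J n + drift.
Proof. by rewrite addrC subrK. Qed.

Lemma core_drift : complex_core drift.
Proof.
split; rewrite /drift !dot_simp ?derA ?dot_n_Jn ?mJJ ?nn /weight; ring.
Qed.

Lemma fundamental_1001 u w : om [tuple iota10 J u; iota01 J w] =
  (m (J u) w *+ 2) +i* (m u w *+ 2).
Proof.
rewrite fundamental_formE /= !lfun_simp J2 !dot_simp !mJJ (dot_Jr J2 mJJ).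
by congr (_ +i* _); ring.
Qed.

Lemma fundamental_0110 u w : om [tuple iota01 J w; iota10 J u] =
  (m (J w) u *+ 2) -i* (m w u *+ 2).
Proof.
rewrite fundamental_formE /= J2 !dot_simp !mJJ (dot_Jr J2 mJJ).
by congr (_ +i* _); ring.
Qed.

Lemma cbracket_1001 x y : complex_core x -> complex_core y -> cbracket (iota10 J x) (iota01 J y) = 0.
Proof.
move=> Ax Ay; have [Jx _] := core_J Ax; have [Jy _] := core_J Ay.
case: Ax Ay => nx _ [ny _].
by rewrite /cbracket /cext_prod /= !bracket_simp !abA // oppr0 subrr addr0.
Qed.

Lemma cbracket_n10 x : complex_core x -> cbracket (iota10 J n) (iota10 J x) = iota10 J (D x).
Proof.
move=> Ax; have [Jx _] := core_J Ax; have [nx _] := Ax.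
rewrite /cbracket /cext_prod /= !bracket_simp !(abA dot_n_Jn) //= D_J // /iota10.
by congr (_, _); mod_ring.
Qed.

Lemma cbracket_n1001 x : complex_core x -> cbracket (iota10 J n) (iota01 J x) = iota01 J (D x).
Proof.
move=> Ax; have [Jx _] := core_J Ax; have [nx _] := Ax.
rewrite /cbracket /cext_prod /= !bracket_simp !(abA dot_n_Jn) //= D_J // /iota01.
by congr (_, _); mod_ring.
Qed.

Lemma cbracket_n01 x : complex_core x -> cbracket (iota01 J n) (iota01 J x) = iota01 J (D x).
Proof.
move=> Ax; have [Jx _] := core_J Ax; have [nx _] := Ax.
rewrite /cbracket /cext_prod /= !(abA dot_n_Jn) //= D_J // /iota01.
by congr (_, _); mod_ring.
Qed.

Lemma cbracketC (u v : gC) : cbracket u v = - cbracket v u.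
Proof.
rewrite /cbracket /cext_prod; apply: injective_projections => /=;
 rewrite (bracketC v.1) (bracketC v.2) ?(bracketC v.2 u.1) ?(bracketC v.1 u.2); mod_ring.
Qed.

Lemma cbracket_an01 a v x : complex_core v -> complex_core x ->
  cbracket (iota01 J (a *: n - J v)) (iota01 J x) = iota01 J (a *: D x).
Proof.
move=> Av Ax; have [Jx _] := core_J Ax; have [nx _] := Ax.
have [Jv _] := core_J Av; have [nv _] := Av.
rewrite /cbracket /cext_prod /= !lfun_simp J2 !bracket_simp.
rewrite !(abA dot_n_Jn) // !(abA nv) // !(abA Jv) //= D_J // /iota01 lfun_simp.
by congr (_, _); mod_ring.
Qed.

Lemma cbracket_an0110 a v x : complex_core v -> complex_core x ->
  cbracket (iota01 J (a *: n - J v)) (iota10 J x) = iota10 J (a *: D x).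
Proof.
move=> Av Ax; have [Jx _] := core_J Ax; have [nx _] := Ax.
have [Jv _] := core_J Av; have [nv _] := Av.
rewrite /cbracket /cext_prod /= !lfun_simp J2 !bracket_simp.
rewrite !(abA dot_n_Jn) // !(abA nv) // !(abA Jv) //= D_J // /iota10 lfun_simp.
by congr (_, _); mod_ring.
Qed.

Lemma cbracket_01n01 x : complex_core x ->
  cbracket (iota01 J x) (iota01 J n) = iota01 J (- D x).
Proof.
move=> Ax; have [Jx _] := core_J Ax; have [nx _] := Ax.
rewrite /cbracket /cext_prod /= (bracketC x n) (bracketC (J x) n).
rewrite !(abA _ dot_n_Jn) //= D_J // /iota01 lfun_simp.
by congr (_, _); mod_ring.
Qed.

Lemma cbracket_0110 x y : complex_core x -> complex_core y -> cbracket (iota01 J x) (iota10 J y) = 0.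
Proof.
move=> Ax Ay; have [Jx _] := core_J Ax; have [Jy _] := core_J Ay.
case: Ax Ay => nx _ [ny _].
by rewrite /cbracket /cext_prod /= !bracket_simp !abA // oppr0 subrr addr0.
Qed.

Lemma fundamental0 u : om [tuple 0; u] = 0.
Proof. exact: (fundamental_zero_entry J m (i := ord0)). Qed.

Lemma cbracket_10n01 x : complex_core x ->
  cbracket (iota10 J x) (iota01 J n) = iota10 J (- D x).
Proof.
move=> Ax; have [Jx _] := core_J Ax; have [nx _] := Ax.
rewrite /cbracket /cext_prod /= !bracket_simp (bracketC x n) (bracketC (J x) n).
rewrite !(abA _ dot_n_Jn) //= D_J // /iota10 lfun_simp.
by congr (_, _); mod_ring.
Qed.

(** The only bracket of the four test vectors that is not of pure type. *)
Lemma cbracket_nn : cbracket (iota10 J n) (iota01 J n) = (0, 2 *: D (J n)).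
Proof.
rewrite /cbracket /cext_prod /= !bracket_simp !bracket_alternating (bracketC _ n).
by congr (_, _); mod_ring.
Qed.

Lemma proj01_nn : proj01 J (0, 2 *: D (J n)) = iota01 J (weight *: n - J drift).
Proof.
by rewrite proj01E //= !lfun_simp D_Jn !lfun_simp J2; congr iota01; mod_field.
Qed.

Local Notation dom := (ce_diff om).

Lemma d_fundamental0 u v : (dom [tuple 0; u; v] = 0) * (dom [tuple u; 0; v] = 0)
  * (dom [tuple u; v; 0] = 0).
Proof.
have z0 := ce_diff2_zero_entry (fundamental_zero_entry J m).
by split; [split|]; [apply: (z0 _ ord0)|apply: (z0 _ (lift ord0 ord0))|apply: (z0 _ ord_max)].
Qed.

Let projE := (proj10_iota10 J2, proj01_iota01 J2, proj10_iota01 J2, proj01_iota10 J2).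

(** The component of bidegree (1,2) of [d omega], on the three kinds of triples
    that occur in [SKT_identity]; [x] stands for an entry of arbitrary type. *)
Lemma delbar_fundamental_100 u v w :
  bidegree_part J 1 dom [tuple iota10 J u; iota01 J v; iota01 J w] =
  dom [tuple iota10 J u; iota01 J v; iota01 J w].
Proof. by rewrite bidegree1_3 !projE !d_fundamental0 !addr0. Qed.

Lemma delbar_fundamental_x10 u v w :
  bidegree_part J 1 dom [tuple u; iota10 J v; iota01 J w] =
  dom [tuple proj01 J u; iota10 J v; iota01 J w].
Proof. by rewrite bidegree1_3 !projE !d_fundamental0 addr0 add0r. Qed.

Lemma delbar_fundamental_x11 u v w :
  bidegree_part J 1 dom [tuple u; iota10 J v; iota10 J w] =
  0.
Proof. by rewrite bidegree1_3 !projE !d_fundamental0 !addr0. Qed.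

Lemma delbar_fundamental_0xx v w :
  bidegree_part J 1 dom [tuple 0; v; w] = 0.
Proof.
have z0 := ce_diff2_zero_entry (fundamental_zero_entry J m).
by apply: (bidegree_zero_entry J _ z0 (i := ord0)).
Qed.

(** The condition on [del (delbar omega)], evaluated at [n - i J n], [x - i J x],
    [n + i J n] and [y + i J y]. The drift contributes nothing, because it brackets to
    zero with the core. Real and imaginary part of the value carry the same
    information, since [x] may be replaced by [J x]. *)
Lemma SKT_identity x y :
    (forall t, del J (delbar J om) t = 0) -> complex_core x -> complex_core y ->
  m (D (D x)) y + m x (D (D y)) + m (D x) (D y) *+ 2
    + weight * (m (D x) y + m x (D y)) = 0.
Proof.
move=> skt Ax Ay.
have ADx := core_D Ax; have ADy := core_D Ay; have AJv := core_J core_drift.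
have := skt [tuple iota10 J n; iota10 J x; iota01 J n; iota01 J y].
rewrite del_delbar_fundamental //.
have z1 := ce_diff3_zero_entry (bidegree_zero_entry J 1
  (ce_diff2_zero_entry (fundamental_zero_entry J m))).
rewrite (@bidegree_homogeneous _ _ J J2 4 2 _ [set ord0; lift ord0 ord0]) //; last first.
  by case=> [[|[|[|[|//]]]] ?]; rewrite !inE /tnth /=;
    first [exact: in10_iota|exact: in01_iota].
rewrite cards2 /= ce_diff3.
rewrite (cbracket_n10 Ax) cbracket_nn (cbracket_n1001 Ay) (cbracket_1001 Ax Ay).
rewrite (cbracket_n01 Ay) (cbracket_10n01 Ax) delbar_fundamental_100 delbar_fundamental_0xx.
rewrite !delbar_fundamental_x11 !delbar_fundamental_x10 !projE proj01_nn d_fundamental0 !oppr0 !addr0.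
rewrite !ce_diff2 (cbracket_10n01 ADx) (cbracket_1001 ADx Ay) (cbracket_n01 Ay).
rewrite (cbracket_an0110 _ core_drift Ax) (cbracket_an01 _ core_drift Ay).
rewrite (cbracket_1001 Ax Ay) (cbracket_0110 ADy Ax) (cbracket_01n01 ADy).
rewrite (cbracket_10n01 Ax) !fundamental0 !fundamental_0110 !fundamental_1001.
move=> /(congr1 (@complex.Im R)) /=.
rewrite !dot_simp !mulr2n oppr0.
rewrite (dotC m (D (D y)) x) (dotC m (D y) x) (dotC m (D y) (D x)) => E.
lra.
Qed.
End Forward.

(** * Unitary frames adapted to the abelian ideal *)

Lemma orthonormal_expand (R : rcfType) (g : vectType R) (m : {dot g for idfun})
    (k : nat) (e : k.-tuple g) :
    (forall i j, m (tnth e i) (tnth e j) = (i == j)%:R) -> \dim {:g} = k ->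
  forall x, x = \sum_(i < k) m (tnth e i) x *: tnth e i.
Proof.
move=> eP dimg x.
have mE (c : 'I_k -> R) j : m (tnth e j) (\sum_(i < k) c i *: tnth e i) = c j.
  rewrite linear_sumr (bigD1 j) //= big1 => [|i ij].
    by rewrite dot_simp eP eqxx mulr1 addr0.
  by rewrite dot_simp eP eq_sym (negPf ij) mulr0.
have : basis_of fullv e.
  rewrite basisEfree subvf size_tuple dimg leqnn !andbT.
  apply/freeP => c c0 j; rewrite -(mE c j).
  rewrite (eq_bigr (fun i : 'I_k => c i *: e`_i)); last by move=> i _; rewrite (tnth_nth 0).
  by rewrite c0 dot_simp.
move=> /coord_basis/(_ (memvf x)) xE.
rewrite {1}xE; apply: eq_bigr => i _; rewrite -tnth_nth; congr (_ *: _).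
rewrite [in RHS]xE.
by rewrite (eq_bigr (fun i : 'I_k => coord e i x *: tnth e i)) ?mE // => j _; rewrite (tnth_nth 0).
Qed.

Section Frames.
Variables (R : rcfType) (g : lieAlgebra R) (J : 'End(g)) (m : {dot g for idfun}).
Hypothesis J2 : forall x, J (J x) = - x.
Hypothesis mJJ : forall x y, m (J x) (J y) = m x y.
Hypothesis dim6 : \dim {:g} = 6.

Lemma unit_line x : m x x = 1 ->
  (m x x = 1) * (m x (J x) = 0) * (m (J x) x = 0) * (m (J x) (J x) = 1).
Proof.
move=> xx; have := dot_Jr J2 mJJ x x; rewrite (dotC m (J x) x) mJJ xx => E.
by have -> : m x (J x) = 0 by lra.
Qed.

Lemma orthogonal_lines x y : m x y = 0 -> m (J x) y = 0 ->
  (m x y = 0) * (m (J x) y = 0) * (m x (J y) = 0) * (m (J x) (J y) = 0) *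
  (m y x = 0) * (m (J y) x = 0) * (m y (J x) = 0) * (m (J y) (J x) = 0).
Proof.
move=> xy Jxy; rewrite !mJJ !(dotC m y) !(dotC m (J y)) xy Jxy.
by rewrite (dot_Jr J2 mJJ) Jxy oppr0.
Qed.

(** The six vectors [n, J n, z, J z, w, J w] are orthonormal; the listed
    relations imply the others because [J] is an isometry with square [-1]. *)
Definition unitary_frame (n z w : g) :=
  [/\ m n n = 1, m z z = 1, m w w = 1,
      [/\ m n z = 0, m (J n) z = 0, m n w = 0 & m (J n) w = 0]
    & m z w = 0 /\ m (J z) w = 0].

Lemma unitary_frame_expand n z w x : unitary_frame n z w ->
  x = m n x *: n + m (J n) x *: J n + m z x *: z + m (J z) x *: J z
      + m w x *: w + m (J w) x *: J w.
Proof.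
case=> nn zz ww [nz Jnz nw Jnw] [zw Jzw].
rewrite {1}(@orthonormal_expand _ _ m _ [tuple n; J n; z; J z; w; J w] _ dim6 x).
  by rewrite !big_ord_recl big_ord0 /tnth /= addr0 !addrA.
case=> [[|[|[|[|[|[|//]]]]]] ?]; case=> [[|[|[|[|[|[|//]]]]]] ?];
  by rewrite /tnth /= ?(unit_line nn, unit_line zz, unit_line ww,
   orthogonal_lines nz Jnz, orthogonal_lines nw Jnw, orthogonal_lines zw Jzw).
Qed.

(** The action of complex numbers on [g] for which [J] is the multiplication by
    [i]. *)
Definition cact (c : R[i]) (x : g) := complex.Re c *: x + complex.Im c *: J x.

Lemma cactM a b x : cact a (cact b x) = cact (a * b) x.
Proof. by case: a b => [a1 a2] [b1 b2]; rewrite /cact /= !lfun_simp !J2; mod_ring. Qed.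

Lemma cactDl a b x : cact (a + b) x = cact a x + cact b x.
Proof. by case: a b => [a1 a2] [b1 b2]; rewrite /cact /=; mod_ring. Qed.

Lemma cactDr a x y : cact a (x + y) = cact a x + cact a y.
Proof. by case: a => [a1 a2]; rewrite /cact /= lfun_simp; mod_ring. Qed.

Hypothesis NJ : forall x y, nijenhuis J x y = 0.
Variable n : g.
Hypothesis nn : m n n = 1.
Hypothesis abA : forall x y, m n x = 0 -> m n y = 0 -> bracket x y = 0.
Hypothesis derA : forall x y, m n (bracket x y) = 0.
Local Notation gC := (complexification g).
Local Notation om := (fundamental_form J m).
Local Notation D := (bracket n).
Local Notation complex_core := (complex_core J m n).

Lemma coreZ a x : complex_core x -> complex_core (a *: x).
Proof. by case=> nx Jx; split; rewrite dot_simp (nx, Jx) mulr0. Qed.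

Lemma coreD x y : complex_core x -> complex_core y -> complex_core (x + y).
Proof. by case=> nx Jx [ny Jy]; split; rewrite dot_simp ?nx ?Jx ?ny ?Jy addr0. Qed.

Lemma core_cact c x : complex_core x -> complex_core (cact c x).
Proof. by move=> Ax; apply: coreD; apply: coreZ => //; apply: core_J. Qed.

Lemma D_cact c x : complex_core x -> D (cact c x) = cact c (D x).
Proof. by move=> Ax; rewrite /cact !bracket_simp (D_J J2 NJ mJJ abA Ax). Qed.

Lemma unitary_frame_exists z : complex_core z -> m z z = 1 -> exists w, unitary_frame n z w.
Proof.
move=> [nz Jnz] zz; have [|w ww wE] := @unit_orthogonal R g m [:: n; J n; z; J z].
  by rewrite dim6.
by exists w; split=> //; [split=> //|split]; apply: wE; rewrite !inE eqxx ?orbT.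
Qed.

Lemma core_expand z w x : unitary_frame n z w -> complex_core x ->
  x = cact (m z x +i* m (J z) x) z + cact (m w x +i* m (J w) x) w.
Proof.
move=> F [nx Jnx]; rewrite {1}(unitary_frame_expand x F) nx Jnx /cact /=.
mod_ring.
Qed.

Lemma frame_core z w : unitary_frame n z w -> complex_core z /\ complex_core w.
Proof. by case=> _ _ _ []. Qed.

Lemma complex_quadratic_root (b c : R[i]) : exists x, x ^+ 2 - b * x + c = 0.
Proof.
exists ((b + sqrtc (b ^+ 2 - 4 * c)) / 2).
have := sqr_sqrtc (b ^+ 2 - 4 * c); set s := sqrtc _ => E.
have -> : ((b + s) / 2) ^+ 2 - b * ((b + s) / 2) + c = (s ^+ 2 - (b ^+ 2 - 4 * c)) / 4.
  by field.
by rewrite E subrr mul0r.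
Qed.

(** [D] is a complex endomorphism of the core, a complex plane; in a unitary
    basis [z, w] an eigenvector for the root [l] of the characteristic polynomial is
    [(l - c22) z + c21 w], unless [c21 = 0] and [z] already is one. *)
Lemma core_eigenvector : exists z c, [/\ complex_core z, m z z = 1 & D z = cact c z].
Proof.
have [|z zz zE] := @unit_orthogonal R g m [:: n; J n]; first by rewrite dim6.
have Az : complex_core z by split; apply: zE; rewrite !inE eqxx ?orbT.
have [w F] := unitary_frame_exists Az zz; have [_ Aw] := frame_core F.
have := core_expand F (core_D J2 NJ mJJ abA derA Az).
have := core_expand F (core_D J2 NJ mJJ abA derA Aw).
move: (_ +i* _) (_ +i* _) (_ +i* _) (_ +i* _) => c21 c11 c22 c12 Dw Dz.
have [c0|c0] := eqVneq c21 0.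
  by exists z, c11; split=> //; rewrite Dz c0 /cact; mod_ring.
have [l lE] := complex_quadratic_root (c11 + c22) (c11 * c22 - c12 * c21).
pose v := cact (l - c22) z + cact c21 w.
have Av : complex_core v by apply: coreD; apply: core_cact.
have Dv : D v = cact l v.
  rewrite /v bracket_simp !D_cact // Dz Dw !(cactDr _ (cact _ _) (cact _ _)) !cactM.
  rewrite addrACA -!cactDl; congr (cact _ z + cact _ w); last by ring.
  apply/eqP; rewrite -subr_eq0; apply/eqP; rewrite -[RHS]oppr0 -[in RHS]lE; ring.
have v0 : v != 0.
  apply: contraNneq c0 => v0.
  case: F => _ _ ww _ [zw Jzw].
  have E1 : m w v = complex.Re c21.
    rewrite /v /cact !dot_simp !(orthogonal_lines zw Jzw) !(unit_line ww); ring.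
  have E2 : m (J w) v = complex.Im c21.
    rewrite /v /cact !dot_simp !(orthogonal_lines zw Jzw) !(unit_line ww); ring.
  by rewrite eq_complex -E1 -E2 v0 !dot_simp /= eqxx.
have [c c1] := unit_multiple m v0.
exists (c *: v), l; split=> //; first exact: coreZ.
by rewrite bracket_simp Dv /cact !lfun_simp; mod_ring.
Qed.

(** Take an eigenvector [z] and a unit vector [w] of the core orthogonal to the
    complex line of [z]; then [D] is upper triangular in this frame, with entry
    [h1 + i h2] off the diagonal. The SKT identity at the pairs [(z, z)], [(w, w)],
    [(z, w)] and [(J z, w)] gives real equations that force this entry to vanish. *)
Lemma SKT_diagonal (a := weight J m n) :
    (forall t, del J (delbar J om) t = 0) ->
  exists z w a1 b1 a2 b2, [/\ unitary_frame n z w,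
    D z = a1 *: z + b1 *: J z, D w = a2 *: w + b2 *: J w,
    a1 * (2 * a1 + a) = 0 & a2 * (2 * a2 + a) = 0].
Proof.
move=> skt; have [z [[a1 b1] [Az zz Dz]]] := core_eigenvector.
have [w F] := unitary_frame_exists Az zz; have [_ Aw] := frame_core F.
have := core_expand F (core_D J2 NJ mJJ abA derA Aw).
move: (_ +i* _) (_ +i* _) => [a2 b2] [h1 h2]; move: Dz; rewrite /cact /= => Dz Dw.
have DJz : D (J z) = a1 *: J z - b1 *: z.
  by rewrite (D_J J2 NJ mJJ abA) // Dz !lfun_simp !J2; mod_ring.
have DJw : D (J w) = a2 *: J w - b2 *: w + h1 *: J z - h2 *: z.
  by rewrite (D_J J2 NJ mJJ abA) // Dw !lfun_simp !J2; mod_ring.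
have id x y := SKT_identity J2 NJ mJJ nn abA derA skt (x := x) (y := y).
have Fs := F; case: F => _ _ ww _ [zw Jzw].
have tab := (unit_line zz, unit_line ww, orthogonal_lines zw Jzw).
have e1 : a1 * (2 * a1 + a) = 0.
  have := id z z Az Az.
  rewrite !(Dz, DJz, bracket_simp) !dot_simp !tab !mulr2n -/a => E; lra.
have e2 : a2 * (2 * a2 + a) + (h1 ^+ 2 + h2 ^+ 2) = 0.
  have := id w w Aw Aw.
  rewrite !(Dz, DJz, Dw, DJw, bracket_simp) !dot_simp !tab !mulr2n -/a => E; nra.
have e3 : (a + 3 * a1 + a2) * h1 - (b2 - b1) * h2 = 0.
  have := id z w Az Aw.
  rewrite !(Dz, DJz, Dw, DJw, bracket_simp) !dot_simp !tab !mulr2n -/a => E; nra.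
have e4 : (a + 3 * a1 + a2) * h2 + (b2 - b1) * h1 = 0.
  have := id (J z) w (core_J J2 mJJ Az) Aw.
  rewrite !(Dz, DJz, Dw, DJw, bracket_simp) !dot_simp !tab !mulr2n -/a => E; nra.
(* [e3] and [e4] are the real and imaginary parts of the product of [h1 + i h2] by
     [(a + 3 a1 + a2) + i (b2 - b1)]; if the second factor vanishes, its real part
     and [e1] express [a1] and [a2] through [a], and [e2] becomes a sum of squares. *)
have h0 : h1 ^+ 2 + h2 ^+ 2 = 0.
  apply/eqP; apply/negPn/negP => h0.
  have : ((a + 3 * a1 + a2) ^+ 2 + (b2 - b1) ^+ 2) * (h1 ^+ 2 + h2 ^+ 2) = 0.
    transitivity (((a + 3 * a1 + a2) * h1 - (b2 - b1) * h2) ^+ 2 +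
     ((a + 3 * a1 + a2) * h2 + (b2 - b1) * h1) ^+ 2); first by ring.
    by rewrite e3 e4; ring.
  move/eqP; rewrite mulf_eq0 (negPf h0) orbF paddr_eq0 ?sqr_ge0 // sqrf_eq0.
  case/andP=> /eqP s0 _; case/eqP: h0.
  move/eqP: e1; rewrite mulf_eq0 => /orP[/eqP a10|/eqP a10].
    have a2E : a2 = - a by lra.
    move: e2; rewrite a2E; nra.
  have a1E : a1 = - (a / 2) by lra.
  have a2E : a2 = a / 2 by lra.
  move: e2; rewrite a2E; nra.
have [h10 h20] : h1 = 0 /\ h2 = 0.
  by move/eqP: h0; rewrite paddr_eq0 ?sqr_ge0 // !sqrf_eq0 => /andP[/eqP-> /eqP->].
exists z, w, a1, b1, a2, b2; split=> //.
  by rewrite Dw h10 h20; mod_ring.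
by rewrite -e2 h0 addr0.
Qed.
End Frames.

Lemma complex_ext (R : rcfType) (x y : R[i]) :
  complex.Re x = complex.Re y -> complex.Im x = complex.Im y -> x = y.
Proof. by case: x y => [a b] [c d] /= -> ->. Qed.

(** * Alternating 2-forms *)

Section Wedge.
Variables (C : fieldType) (W : lmodType C).

Lemma tset2 (u v w : W) :
  (tset [tuple u; v] ord0 w = [tuple w; v]) * (tset [tuple u; v] ord_max w = [tuple u; w]).
Proof. by split; apply: val_inj; rewrite /= !enum_ordSl enum_ord0. Qed.

Lemma ord2P (P : 'I_2 -> Prop) : P ord0 -> P ord_max -> forall i, P i.
Proof.
by move=> P0 P1; case=> [[|[|//]] ?]; [move: P0|move: P1]; congr P; apply: val_inj.
Qed.

Definition wedge (f h : W -> C) (t : 2.-tuple W) : C :=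
  f (tnth t ord0) * h (tnth t ord_max) - h (tnth t ord0) * f (tnth t ord_max).

Lemma wedgeE f h u v : wedge f h [tuple u; v] = f u * h v - h u * f v.
Proof. by []. Qed.

Definition functional (f : W -> C) := forall a u v, f (a *: u + v) = a * f u + f v.

Lemma wedge_multilinear f h : functional f -> functional h -> multilinear (wedge f h).
Proof.
move=> fl hl t i a u v; rewrite (tuple2E t); elim/ord2P: i;
  by rewrite !tset2 /wedge /tnth /= !fl !hl; ring.
Qed.

Lemma wedge_alternating f h : alternating (wedge f h).
Proof.
move=> t i j; elim/ord2P: i; elim/ord2P: j => // _ E; rewrite /wedge E; ring.
Qed.

Variable al : 2.-tuple W -> C.
Hypothesis alM : multilinear al.
Hypothesis alA : alternating al.

Lemma bilinear2l a u v w : al [tuple a *: u + v; w] = a * al [tuple u; w] + al [tuple v; w].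
Proof. by have := alM [tuple u; w] ord0 a u v; rewrite !tset2. Qed.

Lemma bilinear2r a u v w : al [tuple w; a *: u + v] = a * al [tuple w; u] + al [tuple w; v].
Proof. by have := alM [tuple w; u] ord_max a u v; rewrite !tset2. Qed.

Lemma alternating2 u : al [tuple u; u] = 0.
Proof. exact: (alA (i := ord0) (j := ord_max)). Qed.

Lemma bilinear2_0l w : al [tuple 0; w] = 0.
Proof.
have := bilinear2l 1 0 0 w; rewrite scaler0 addr0 mul1r => /eqP.
by rewrite -subr_eq subrr eq_sym => /eqP.
Qed.

Lemma bilinear2_0r w : al [tuple w; 0] = 0.
Proof.
have := bilinear2r 1 0 0 w; rewrite scaler0 addr0 mul1r => /eqP.
by rewrite -subr_eq subrr eq_sym => /eqP.
Qed.

Lemma bilinear2Zl a u w : al [tuple a *: u; w] = a * al [tuple u; w].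
Proof. by rewrite -[a *: u]addr0 bilinear2l bilinear2_0l addr0. Qed.

Lemma bilinear2Zr a u w : al [tuple w; a *: u] = a * al [tuple w; u].
Proof. by rewrite -[a *: u]addr0 bilinear2r bilinear2_0r addr0. Qed.

Lemma bilinear2Dl u v w : al [tuple u + v; w] = al [tuple u; w] + al [tuple v; w].
Proof. by rewrite -[u]scale1r bilinear2l mul1r scale1r. Qed.

Lemma bilinear2Dr u v w : al [tuple w; u + v] = al [tuple w; u] + al [tuple w; v].
Proof. by rewrite -[u]scale1r bilinear2r mul1r scale1r. Qed.

Lemma alternating2C u v : al [tuple u; v] = - al [tuple v; u].
Proof.
have := alternating2 (u + v).
rewrite bilinear2Dl !bilinear2Dr !alternating2 add0r addr0 => /eqP.
by rewrite addr_eq0 => /eqP.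
Qed.

(** An alternating 2-form on a three-dimensional space is determined by its
    values on the three pairs of basis vectors, and the coefficients are the
    coordinates of the bivector. *)
Lemma alternating_3dim (e0 e1 e2 : W) (x0 x1 x2 y0 y1 y2 : C) :
  al [tuple x0 *: e0 + x1 *: e1 + x2 *: e2; y0 *: e0 + y1 *: e1 + y2 *: e2] =
  (x0 * y1 - x1 * y0) * al [tuple e0; e1] + (x0 * y2 - x2 * y0) * al [tuple e0; e2]
  + (x1 * y2 - x2 * y1) * al [tuple e1; e2].
Proof.
rewrite !bilinear2Dl !bilinear2Dr !bilinear2Zl !bilinear2Zr !alternating2.
rewrite (alternating2C e1 e0) (alternating2C e2 e0) (alternating2C e2 e1); ring.
Qed.
End Wedge.

(** * Holomorphic bivectors *)

Section Poisson.
Variables (R : rcfType) (g : lieAlgebra R) (J : 'End(g)).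
Hypothesis J2 : forall x, J (J x) = - x.
Hypothesis NJ : forall x y, nijenhuis J x y = 0.
Local Notation gC := (complexification g).

(** Vanishing of the Nijenhuis tensor of [r] and [x] turns the four real
    brackets in the projection into two. *)
Lemma dbar_iota r x :
  dbar J (iota01 J r) (iota10 J x) = iota10 J (bracket r x + J (bracket (J r) x)).
Proof.
rewrite /dbar proj10E //; congr iota10.
rewrite /cbracket /cext_prod /= !bracket_simp !lfun_simp.
have := NJ r x; rewrite /nijenhuis => /eqP; rewrite !subr_eq add0r => /eqP ->.
mod_field.
Qed.

Lemma cscale_iota10 c x : c *: iota10 J x = iota10 J (cact J c x).
Proof.
case: c => c d; rewrite cscaleE /iota10 /cact /= !lfun_simp J2.
by congr (_, _); mod_ring.
Qed.

Lemma iota10D x y : iota10 J (x + y) = iota10 J x + iota10 J y.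
Proof.
rewrite /iota10 lfun_simp; apply: injective_projections => //=; mod_ring.
Qed.

Lemma big_dbar_bivector (x : gC) (pi : multivector gC 2) (al : 2.-tuple gC -> R[i]) :
  \sum_(t <- dbar_bivector J x pi) al t =
  \sum_(t <- pi) (al [tuple dbar J x (tnth t ord0); tnth t ord_max] +
                 al [tuple tnth t ord0; dbar J x (tnth t ord_max)]).
Proof.
rewrite /dbar_bivector big_flatten big_map; apply: eq_bigr => t _.
by rewrite big_cons big_seq1.
Qed.

(** The complex-linear extension of a real functional to the complexification. *)
Definition cextend (f : g -> R) (z : gC) : R[i] := f z.1 +i* f z.2.

Lemma cextend_functional (f : g -> R) :
  (forall a u v, f (a *: u + v) = a * f u + f v) -> functional (cextend f).
Proof.
move=> fl [a b] [u1 u2] [v1 v2]; rewrite cscaleE /cextend /=.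
have f0 : f 0 = 0.
  by have := fl 1 0 0; rewrite !scaler0 !add0r mul1r => E; lra.
have fZ c x : f (c *: x) = c * f x by rewrite -[c *: x]addr0 fl f0 addr0.
have fD x y : f (x + y) = f x + f y by rewrite -[x]scale1r fl mul1r scale1r.
have fN x : f (- x) = - f x by rewrite -scaleN1r fZ mulN1r.
by apply: complex_ext; rewrite /= !(fD, fN, fZ).

Qed.

Lemma cbracketPr (c : R[i]) (x u v : gC) :
  cbracket x (c *: u + v) = c *: cbracket x u + cbracket x v.
Proof.
rewrite /cbracket /cext_prod !cscaleE.
by apply: injective_projections => /=; rewrite !bracket_simp; mod_ring.
Qed.

Lemma proj10P (c : R[i]) (u v : gC) :
  proj10 J (c *: u + v) = c *: proj10 J u + proj10 J v.
Proof.
rewrite /proj10; have -> : cext J (c *: u + v) = c *: cext J u + cext J v.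
  by rewrite /cext !cscaleE; apply: injective_projections => /=; rewrite !lfun_simp.
rewrite (scalerDr 'i%C) opprD addrACA (scalerA 'i%C) (mulrC 'i%C) -(scalerA c).
by rewrite -scalerBr scalerDr scalerA mulrC -scalerA.
Qed.

Lemma dbarP (c : R[i]) (x u v : gC) :
  dbar J x (c *: u + v) = c *: dbar J x u + dbar J x v.
Proof. by rewrite /dbar cbracketPr proj10P. Qed.

Lemma dbar0 (x : gC) : dbar J x 0 = 0.
Proof. by have := dbarP (-1) x 0 0; rewrite scaler0 addr0 scaleN1r addNr. Qed.

Variable m : {dot g for idfun}.
Hypothesis mJJ : forall x y, m (J x) (J y) = m x y.
Hypothesis dim6 : \dim {:g} = 6.
Variable n : g.
Hypothesis abA : forall x y, m n x = 0 -> m n y = 0 -> bracket x y = 0.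
Local Notation D := (bracket n).

Lemma dot_functional u : functional (cextend (m u)).
Proof. by apply: cextend_functional => a x y; rewrite !dot_simp. Qed.

Variables (z w : g) (a : R) (v : g) (l1 l2 : R[i]).
Hypothesis F : unitary_frame J m n z w.
Hypothesis Av : complex_core J m n v.
Hypothesis DJn : D (J n) = a *: J n + v.
Hypothesis Dz : D z = cact J l1 z.
Hypothesis Dw : D w = cact J l2 w.

Local Notation T := (iota10 J n).
Local Notation Z := (iota10 J z).
Local Notation W := (iota10 J w).
Local Notation tau := (cextend (m n)).
Local Notation zeta1 := (cextend (m z)).
Local Notation zeta2 := (cextend (m w)).

Lemma cextend_iota10 u x : cextend (m u) (iota10 J x) = m u x +i* m (J u) x.
Proof. by rewrite /cextend /= dot_simp (dot_Jr J2 mJJ) opprK. Qed.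

Lemma g10_expand u : in10 J u -> u = tau u *: T + zeta1 u *: Z + zeta2 u *: W.
Proof.
move=> /(in10P J2) ->; move: u.1 => x; rewrite !cscale_iota10 -!iota10D !cextend_iota10.
by congr iota10; rewrite {1}(unitary_frame_expand J2 mJJ dim6 x F) /cact /=; mod_ring.
Qed.

Lemma frame_dual :
  (tau T = 1) * (tau Z = 0) * (tau W = 0) * (zeta1 T = 0) * (zeta1 Z = 1)
  * (zeta1 W = 0) * (zeta2 T = 0) * (zeta2 Z = 0) * (zeta2 W = 1).
Proof.
case: F => nn zz ww [nz Jnz nw Jnw] [zw Jzw].
by rewrite !cextend_iota10 !(unit_line J2 mJJ nn, unit_line J2 mJJ zz, unit_line J2 mJJ ww,
  orthogonal_lines J2 mJJ nz Jnz, orthogonal_lines J2 mJJ nw Jnw,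
  orthogonal_lines J2 mJJ zw Jzw).
Qed.

(** [dbar] along the conjugate of [n - i J n] is triangular in the basis of
    (1,0)-vectors given by the frame; the drift produces the entries [w1] and [w2]. *)
Lemma dbar_frame : exists w1 w2,
  [/\ dbar J (iota01 J n) T = a%:C *: T + w1 *: Z + w2 *: W,
      dbar J (iota01 J n) Z = l1 *: Z & dbar J (iota01 J n) W = l2 *: W].
Proof.
have [[nz _] [nw _]] := frame_core F.
have nJn : m n (J n) = 0 := dot_n_Jn J2 mJJ n.
have [Jv1 Jv2] := core_J J2 mJJ Av.
exists (cextend (m z) (iota10 J (- J v))), (cextend (m w) (iota10 J (- J v))).
split; rewrite dbar_iota.
- rewrite bracket_alternating add0r (bracketC (J n)) !lfun_simp DJn !lfun_simp J2.
  have -> : - (a *: - n + J v) = a *: n + - J v by mod_ring.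
  rewrite iota10D {1}[iota10 J (- J v)]g10_expand; last exact: in10_iota.
  have -> : cextend (m n) (iota10 J (- J v)) = 0.
    by rewrite cextend_iota10 !dot_simp Jv1 Jv2 oppr0.
  rewrite scale0r add0r -addrA; congr (_ + _).
  by rewrite cscale_iota10 /cact /= scale0r addr0.
- by rewrite cscale_iota10 Dz (abA nJn nz) lfun_simp addr0.
- by rewrite cscale_iota10 Dw (abA nJn nw) lfun_simp addr0.
Qed.

(** If the three eigenvalues of dbar on bivectors are nonzero, testing
    holomorphicity on [tau /\ zeta1], [tau /\ zeta2] and then [zeta1 /\ zeta2]
    shows that the three coordinates of the bivector vanish, hence the bivector does. *)
Lemma Poisson_eigenvalues (pi : multivector gC 2) :
    is_holomorphic_poisson J pi -> ~ mv_zero pi ->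
  (l1 + l2) * (a%:C + l1) * (a%:C + l2) = 0.
Proof.
case=> pi10 dpi _ pi_neq0; apply/eqP/negPn/negP; rewrite !mulf_eq0 !negb_or.
case/andP => /andP[l12 al1] al2; apply: pi_neq0.
have [w1 [w2 [dT dZ dW]]] := dbar_frame.
have {}dpi := dpi _ (in01_iota J2 n).
have dE u : in10 J u -> dbar J (iota01 J n) u =
    (a%:C * tau u) *: T + (w1 * tau u + l1 * zeta1 u) *: Z
    + (w2 * tau u + l2 * zeta2 u) *: W.
  move=> u10; rewrite {1}(g10_expand u10) -addrA !dbarP.
  rewrite -[zeta2 u *: W]addr0 dbarP dbar0 addr0 dT dZ dW.
  rewrite !scalerDr !scalerA -!addrA [a%:C * _]mulrC; congr (_ + _).
  rewrite addrA addrACA [w1 * _]mulrC [l1 * _]mulrC [w2 * _]mulrC [l2 * _]mulrC.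
  by rewrite !scalerDl.
have cE f x0 x1 x2 : functional f ->
    f (x0 *: T + x1 *: Z + x2 *: W) = x0 * f T + x1 * f Z + x2 * f W.
  move=> fl; rewrite -addrA !fl addrA -[x2 *: W]addr0 fl.
  have -> : f 0 = 0; last by rewrite addr0.
  by have := fl (-1) 0 0; rewrite scaler0 addr0 mulN1r addNr.
have tl := dot_functional n; have z1l := dot_functional z; have z2l := dot_functional w.
have tauE u : in10 J u -> tau (dbar J (iota01 J n) u) = a%:C * tau u.
  by move=> u10; rewrite dE // cE // !frame_dual; ring.
have zeta1E u : in10 J u ->
    zeta1 (dbar J (iota01 J n) u) = w1 * tau u + l1 * zeta1 u.
  by move=> u10; rewrite dE // cE // !frame_dual; ring.
have zeta2E u : in10 J u ->
    zeta2 (dbar J (iota01 J n) u) = w2 * tau u + l2 * zeta2 u.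
  by move=> u10; rewrite dE // cE // !frame_dual; ring.
have sumP f h : functional f -> functional h ->
    \sum_(t <- pi) (wedge f h [tuple dbar J (iota01 J n) (tnth t ord0); tnth t ord_max] +
      wedge f h [tuple tnth t ord0; dbar J (iota01 J n) (tnth t ord_max)]) = 0.
  move=> fl hl; rewrite -big_dbar_bivector; apply: dpi.
    exact: wedge_multilinear.
  exact: wedge_alternating.
pose P f h := \sum_(t <- pi) wedge f h t.
have P01 : P tau zeta1 = 0.
  apply/eqP; rewrite -(mulrI_eq0 _ (mulfI al1)) mulr_sumr; apply/eqP.
  rewrite -[RHS](sumP _ _ tl z1l); apply: eq_big_seq => t tpi.
  by rewrite !wedgeE !(tauE, zeta1E) /wedge; first [exact: pi10|ring].
have P02 : P tau zeta2 = 0.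
  apply/eqP; rewrite -(mulrI_eq0 _ (mulfI al2)) mulr_sumr; apply/eqP.
  rewrite -[RHS](sumP _ _ tl z2l); apply: eq_big_seq => t tpi.
  by rewrite !wedgeE !(tauE, zeta2E) /wedge; first [exact: pi10|ring].
(* The equation for [zeta1 /\ zeta2] also involves the other two coordinates,
   through [w1] and [w2]; they are zero by now. *)
have P12 : P zeta1 zeta2 = 0.
  apply/eqP; rewrite -(mulrI_eq0 _ (mulfI l12)); apply/eqP.
  rewrite -[RHS](sumP _ _ z1l z2l).
  have -> : (l1 + l2) * P zeta1 zeta2
    = (l1 + l2) * P zeta1 zeta2 + w1 * P tau zeta2 - w2 * P tau zeta1.
    by rewrite P01 P02; ring.
  rewrite !mulr_sumr -sumrN -!big_split /=; apply: eq_big_seq => t tpi.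
  by rewrite !wedgeE !(zeta1E, zeta2E) /wedge; first [exact: pi10|ring].
move=> al alM alA.
transitivity (P tau zeta1 * al [tuple T; Z] + P tau zeta2 * al [tuple T; W]
    + P zeta1 zeta2 * al [tuple Z; W]); last by rewrite P01 P02 P12; ring.
have sM f h c : P f h * c = \sum_(t <- pi) wedge f h t * c by apply: mulr_suml.
transitivity (\sum_(t <- pi) (wedge tau zeta1 t * al [tuple T; Z]
    + wedge tau zeta2 t * al [tuple T; W] + wedge zeta1 zeta2 t * al [tuple Z; W])).
  apply: eq_big_seq => t tpi.
  rewrite {1}(tuple2E t) (g10_expand (pi10 t ord0 tpi)) (g10_expand (pi10 t ord_max tpi)).
  rewrite alternating_3dim // /wedge; ring.
rewrite big_split big_split.
by congr (_ + _ + _); symmetry; apply: sM.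
Qed.
End Poisson.

(** * Normal forms *)

Section Rows.
Variable F : fieldType.

Definition row6 (c0 c1 c2 c3 c4 c5 : F) : 'rV[F]_6 :=
  \row_(i < 6) nth 0 [:: c0; c1; c2; c3; c4; c5] i.

Lemma row6E (c0 c1 c2 c3 c4 c5 : F) :
  let r := row6 c0 c1 c2 c3 c4 c5 in
  (r 0 (inord 0) = c0) * (r 0 (inord 1) = c1) * (r 0 (inord 2) = c2) *
  (r 0 (inord 3) = c3) * (r 0 (inord 4) = c4) * (r 0 (inord 5) = c5).
Proof. by rewrite /= !mxE !inordK. Qed.

Lemma row6_ext (p q : 'rV[F]_6) :
  p 0 (inord 0) = q 0 (inord 0) -> p 0 (inord 1) = q 0 (inord 1) ->
  p 0 (inord 2) = q 0 (inord 2) -> p 0 (inord 3) = q 0 (inord 3) ->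
  p 0 (inord 4) = q 0 (inord 4) -> p 0 (inord 5) = q 0 (inord 5) -> p = q.
Proof.
move=> E0 E1 E2 E3 E4 E5; apply/rowP => i; rewrite -(inord_val i).
by case: i => [[|[|[|[|[|[|//]]]]]] ?] /=.
Qed.

Lemma dim_row6 : \dim {:'rV[F]_6} = 6.
Proof. by rewrite dimvf dim_matrix. Qed.

(** The almost abelian bracket on the coordinates along a basis
    [e1, x1, y1, x2, y2, e6] such that [ad e6] maps [e1] to [a e1 + c x1], and acts on
    the planes of [x1, y1] and [x2, y2] as rotations with speeds [mu1] and [mu2];
    the other five vectors span an abelian ideal. *)
Definition nf_bracket (a c mu1 mu2 : F) (p q : 'rV[F]_6) : 'rV[F]_6 :=
  let w i := p 0 (inord 5) * q 0 (inord i) - q 0 (inord 5) * p 0 (inord i) in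
  row6 (a * w 0%N) (c * w 0%N - mu1 * w 2%N) (mu1 * w 1%N) (- mu2 * w 4%N)
    (mu2 * w 3%N) 0.

(** A linear isomorphism with the coordinate model, rather than a basis of [g]:
    composing such isomorphisms compares algebras, and their inverses provide
    coordinates. *)
Definition normal_form (g : lieAlgebra F) a c mu1 mu2 : Prop :=
  exists phi : {linear 'rV[F]_6 -> g}, bijective phi /\
    forall p q, bracket (phi p) (phi q) = phi (nf_bracket a c mu1 mu2 p q).

Lemma normal_form_isomorphic (g h : lieAlgebra F) a c mu1 mu2 :
  normal_form g a c mu1 mu2 -> normal_form h a c mu1 mu2 -> lie_isomorphic g h.
Proof.
case=> phi [[phi' phiK phi'K] phiB] [psi [psi_bij psiB]].
have lin' : linear (psi \o phi').
  move=> k x y /=; rewrite -linearP; congr (psi _).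
  by apply: (can_inj phiK); rewrite linearP !phi'K.
pose f := GRing.isLinear.Build F g h _ _ lin'.
pose f' : {linear g -> h} := HB.pack (psi \o phi') f.
exists f'; split.
  by apply: (bij_comp psi_bij); exists phi.
move=> x y; rewrite /f' /= psiB; congr (psi _).
by apply: (can_inj phiK); rewrite -phiB !phi'K.
Qed.

Lemma normal_form_transport (g h : lieAlgebra F) a c mu1 mu2 :
  lie_isomorphic g h -> normal_form h a c mu1 mu2 -> normal_form g a c mu1 mu2.
Proof.
case=> f [[f' fK f'K] fB] [phi [phi_bij phiB]].
have lin' : linear (f' \o phi).
  move=> k x y /=; apply: (can_inj fK); by rewrite [RHS]linearP !f'K linearP.
pose fm := GRing.isLinear.Build F 'rV[F]_6 g _ _ lin'.
pose psi : {linear 'rV[F]_6 -> g} := HB.pack (f' \o phi) fm.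
exists psi; split.
  by apply: bij_comp phi_bij; exists f.
by move=> p q; apply: (can_inj fK); rewrite fB /psi /= !f'K.
Qed.

(** Six vectors that span a six-dimensional space form a basis, so spanning is
    all that a change of basis has to check. *)
Lemma normal_form_of_basis (g : lieAlgebra F) (e1 x1 y1 x2 y2 e6 : g) a c mu1 mu2 :
    \dim {:g} = 6 ->
    (forall u, exists k1 k2 k3 k4 k5 k6,
       u = k1 *: e1 + k2 *: x1 + k3 *: y1 + k4 *: x2 + k5 *: y2 + k6 *: e6) ->
    {in [:: e1; x1; y1; x2; y2] &, forall u v, bracket u v = 0} ->
    bracket e6 e1 = a *: e1 + c *: x1 ->
    bracket e6 x1 = mu1 *: y1 -> bracket e6 y1 = - mu1 *: x1 ->
    bracket e6 x2 = mu2 *: y2 -> bracket e6 y2 = - mu2 *: x2 ->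
  normal_form g a c mu1 mu2.
Proof.
move=> dim6 spans abA De1 Dx1 Dy1 Dx2 Dy2.
pose f0 (p : 'rV[F]_6) : g := p 0 (inord 0) *: e1 + p 0 (inord 1) *: x1
  + p 0 (inord 2) *: y1 + p 0 (inord 3) *: x2 + p 0 (inord 4) *: y2
  + p 0 (inord 5) *: e6.
have lin0 : linear f0 by move=> k p q; rewrite /f0 !mxE; mod_ring.
pose f : {linear 'rV[F]_6 -> g} := HB.pack f0 (GRing.isLinear.Build F 'rV[F]_6 g _ _ lin0).
exists f; split.
  have surj u : exists p, f p = u.
    have [k1 [k2 [k3 [k4 [k5 [k6 ->]]]]]] := spans u.
    by exists (row6 k1 k2 k3 k4 k5 k6); rewrite /f /= /f0 !row6E.
  have img : limg (linfun f) = fullv.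
    apply/eqP; rewrite eqEsubv subvf; apply/subvP => u _.
    by have [p <-] := surj u; rewrite -lfunE memv_img ?memvf.
  have ker : lker (linfun f) = 0%VS.
    apply/eqP; rewrite -dimv_eq0.
    have := limg_ker_dim (linfun f) fullv; rewrite img dim6 capfv.
    rewrite [X in _ = X -> _]dim_row6.
    by move: (\dim _) => d E; rewrite -(eqn_add2r 6) E.
  exists (fun u => (linfun f)^-1%VF u) => u.
    have := lker0_lfunK (f := linfun f); rewrite ker => /(_ (eqxx _) u).
    by rewrite lfunE.
  have [p <-] := surj u; have := lker0_lfunK (f := linfun f).
  by rewrite ker => /(_ (eqxx _) p); rewrite lfunE => ->.
move=> p q; rewrite /f /= /f0 !row6E.
have e6e6 := bracket_alternating e6.
have ab u v : u \in [:: e1; x1; y1; x2; y2] -> v \in [:: e1; x1; y1; x2; y2] ->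
  bracket u v = 0 by move=> *; apply: abA.
have i1 : e1 \in [:: e1; x1; y1; x2; y2] by rewrite !inE eqxx.
have i2 : x1 \in [:: e1; x1; y1; x2; y2] by rewrite !inE eqxx ?orbT.
have i3 : y1 \in [:: e1; x1; y1; x2; y2] by rewrite !inE eqxx ?orbT.
have i4 : x2 \in [:: e1; x1; y1; x2; y2] by rewrite !inE eqxx ?orbT.
have i5 : y2 \in [:: e1; x1; y1; x2; y2] by rewrite !inE eqxx ?orbT.
rewrite !bracket_simp e6e6 (bracketC e1 e6) (bracketC x1 e6) (bracketC y1 e6)
  (bracketC x2 e6) (bracketC y2 e6) !(ab _ _ i1) // !(ab _ _ i2) // !(ab _ _ i3) //
  !(ab _ _ i4) // !(ab _ _ i5) // De1 Dx1 Dy1 Dx2 Dy2.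
mod_ring.
Qed.
End Rows.

(** * The five algebras of the list in normal form *)

Section Models.
Variable F : fieldType.

Lemma str_bracket_coord (al : seq 'M[F]_6) x y i : (i < 6)%N ->
  str_bracket al x y 0 (inord i) = - (x *m al`_i *m y^T) 0 0.
Proof. by move=> i6; rewrite str_bracketE inordK. Qed.

Lemma f2E j k (x y : 'rV[F]_6) : (x *m f2 F j k *m y^T) 0 0 =
  x 0 (inord j.-1) * y 0 (inord k.-1) - x 0 (inord k.-1) * y 0 (inord j.-1).
Proof. by rewrite -[f2 F j k]scale1r scale_f2E mul1r. Qed.

Lemma f2NE j k (x y : 'rV[F]_6) : (x *m - f2 F j k *m y^T) 0 0 =
  - (x 0 (inord j.-1) * y 0 (inord k.-1) - x 0 (inord k.-1) * y 0 (inord j.-1)).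
Proof. by rewrite -[- f2 F j k]scaleN1r scale_f2E mulN1r. Qed.

Lemma f20E (x y : 'rV[F]_6) : (x *m 0 *m y^T) 0 0 = 0.
Proof. by rewrite mulmx0 mul0mx mxE. Qed.

Local Notation u0 := (row6 1 0 0 0 0 0 : 'rV[F]_6).
Local Notation u1 := (row6 0 1 0 0 0 0 : 'rV[F]_6).
Local Notation u2 := (row6 0 0 1 0 0 0 : 'rV[F]_6).
Local Notation u3 := (row6 0 0 0 1 0 0 : 'rV[F]_6).
Local Notation u4 := (row6 0 0 0 0 1 0 : 'rV[F]_6).
Local Notation u5 := (row6 0 0 0 0 0 1 : 'rV[F]_6).

Ltac bracket_table :=
  rewrite -[bracket _ _]/(str_bracket _ _ _);
  apply: row6_ext; rewrite str_bracket_coord //= ?scale_f2E ?f2E ?f2NE ?f20E /=;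
  rewrite ?(row6E, mxE); rewrite ?inordK //=; ring.

Ltac spans_table k0 k1 k2 k3 k4 :=
  let u := fresh "u" in
  move=> u; exists ((u : 'rV[F]_6) 0 (inord k0)), ((u : 'rV[F]_6) 0 (inord k1)), ((u : 'rV[F]_6) 0 (inord k2)),
    ((u : 'rV[F]_6) 0 (inord k3)), ((u : 'rV[F]_6) 0 (inord k4)), ((u : 'rV[F]_6) 0 (inord 5));
  by apply: row6_ext; rewrite !mxE !inordK //=; ring.

Ltac abelian_table :=
  let u := fresh "u" in let v := fresh "v" in
  let uE := fresh "uE" in let vE := fresh "vE" in
  let u5 := fresh "u5" in let v5 := fresh "v5" in
  move=> u v uE vE;
  have u5 : (u : 'rV[F]_6) 0 (inord 5) = 0
    by [move: uE; rewrite !inE => /or4P[|||/orP[]] /eqP ->; rewrite row6E];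
  have v5 : (v : 'rV[F]_6) 0 (inord 5) = 0
    by [move: vE; rewrite !inE => /or4P[|||/orP[]] /eqP ->; rewrite row6E];
  rewrite -[bracket _ _]/(str_bracket _ _ _); 
  apply: row6_ext; rewrite str_bracket_coord //= ?scale_f2E ?f2E ?f2NE ?f20E /=;
  rewrite ?u5 ?v5 ?mxE; ring.

Lemma normal_form_k11 (p : F) : normal_form (k11 p) p 0 1 (-1).
Proof.
apply: (@normal_form_of_basis F (k11 p) u0 u2 u1 u3 u4 u5);
  [exact: dim_row6|spans_table 0%N 2%N 1%N 3%N 4%N|abelian_table|bracket_table ..].
Qed.

Lemma normal_form_k13 : normal_form (k13 F) 1 0 0 0.
Proof.
apply: (@normal_form_of_basis F (k13 F) u0 u1 u2 u3 u4 u5);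
  [exact: dim_row6|spans_table 0%N 1%N 2%N 3%N 4%N|abelian_table|bracket_table ..].
Qed.

Lemma normal_form_k15 : normal_form (k15 F) 0 0 0 1.
Proof.
apply: (@normal_form_of_basis F (k15 F) u2 u3 u4 u1 u0 u5);
  [exact: dim_row6|spans_table 2%N 3%N 4%N 1%N 0%N|abelian_table|bracket_table ..].
Qed.

Lemma normal_form_k23 : normal_form (k23 F) 0 1 0 1.
Proof.
apply: (@normal_form_of_basis F (k23 F) u3 u2 u4 u1 u0 u5);
  [exact: dim_row6|spans_table 3%N 2%N 4%N 1%N 0%N|abelian_table|bracket_table ..].
Qed.

Lemma normal_form_k25 : normal_form (k25 F) 0 0 1 (-1).
Proof.
apply: (@normal_form_of_basis F (k25 F) u4 u1 u0 u2 u3 u5);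
  [exact: dim_row6|spans_table 4%N 1%N 0%N 2%N 3%N|abelian_table|bracket_table ..].
Qed.
End Models.

(** * Reduction to the normal forms *)

Definition poisson_normal_forms (R : rcfType) (g : lieAlgebra R) : Prop :=
  (exists p : R, p <> 0 /\ normal_form g p 0 1 (-1)) \/
  normal_form g 1 0 0 0 \/ normal_form g 0 0 0 1 \/
  normal_form g 0 1 0 1 \/ normal_form g 0 0 1 (-1).

(** The complex equation [(a - i b) (r + i s) = p + i q], written with real
    numbers; it can be solved as soon as the eigenvalue [i b] differs from [a]. *)
Lemma resolvent (R : rcfType) (a b p q : R) : a != 0 \/ b != 0 ->
  exists r s, p - s * b = a * r /\ q + r * b = a * s.
Proof.
move=> ab; have N0 : a ^+ 2 + b ^+ 2 != 0.
  rewrite paddr_eq0 ?sqr_ge0 // !sqrf_eq0 negb_and.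
  by case: ab => ->; rewrite ?orbT.
exists ((a * p - b * q) / (a ^+ 2 + b ^+ 2)), ((a * q + b * p) / (a ^+ 2 + b ^+ 2)).
by split; field.
Qed.

Section Classification.
Variables (R : rcfType) (g : lieAlgebra R) (J : 'End(g)) (m : {dot g for idfun}).
Hypothesis J2 : forall x, J (J x) = - x.
Hypothesis mJJ : forall x y, m (J x) (J y) = m x y.
Hypothesis dim6 : \dim {:g} = 6.
Hypothesis NJ : forall x y, nijenhuis J x y = 0.
Variable n : g.
Hypothesis abA : forall x y, m n x = 0 -> m n y = 0 -> bracket x y = 0.
Local Notation D := (bracket n).

Variables (z w v : g) (a b1 b2 : R).
Hypothesis F : unitary_frame J m n z w.
Hypothesis Av : complex_core J m n v.
Hypothesis DJn : D (J n) = a *: J n + v.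
Hypothesis Dz : D z = b1 *: J z.
Hypothesis Dw : D w = b2 *: J w.

Lemma frame_D_Jz : D (J z) = - b1 *: z.
Proof.
have [Az _] := frame_core F.
by rewrite (D_J J2 NJ mJJ abA Az) Dz lfun_simp J2; mod_ring.
Qed.

Lemma frame_D_Jw : D (J w) = - b2 *: w.
Proof.
have [_ Aw] := frame_core F.
by rewrite (D_J J2 NJ mJJ abA Aw) Dw lfun_simp J2; mod_ring.
Qed.

Lemma drift_coordinates : exists p1 q1 p2 q2,
  v = p1 *: z + q1 *: J z + p2 *: w + q2 *: J w.
Proof.
exists (m z v), (m (J z) v), (m w v), (m (J w) v).
by rewrite {1}(core_expand J2 mJJ dim6 F Av) /cact /=; mod_ring.
Qed.

Lemma frame_orthogonal :
  (m n (J n) = 0) * (m n z = 0) * (m n (J z) = 0) * (m n w = 0) * (m n (J w) = 0).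
Proof.
have [[nz Jz] [nw Jw]] := frame_core F.
by rewrite (dot_n_Jn J2 mJJ) nz nw !(dot_Jr J2 mJJ) Jz Jw oppr0.
Qed.

Lemma frame_spans u : exists k1 k2 k3 k4 k5 k6, u =
  k1 *: J n + k2 *: z + k3 *: J z + k4 *: w + k5 *: J w + k6 *: n.
Proof.
exists (m (J n) u), (m z u), (m (J z) u), (m w u), (m (J w) u), (m n u).
rewrite {1}(unitary_frame_expand J2 mJJ dim6 u F); mod_ring.
Qed.

(** Adding to [J n] a vector of the core changes the drift by the image of
    [D - a], so it can be removed when [a] is not an eigenvalue on either line. *)
Lemma normal_form_without_drift s : s != 0 ->
    a != 0 \/ b1 != 0 -> a != 0 \/ b2 != 0 ->
  normal_form g (s * a) 0 (s * b1) (s * b2).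
Proof.
move=> s0 ab1 ab2; have [p1 [q1 [p2 [q2 vE]]]] := drift_coordinates.
have [r1 [s1 [E1 E2]]] := resolvent p1 q1 ab1.
have [r2 [s2 [E3 E4]]] := resolvent p2 q2 ab2.
pose e1 := J n + r1 *: z + s1 *: J z + r2 *: w + s2 *: J w.
apply: (@normal_form_of_basis R g e1 z (J z) w (J w) (s *: n)) => //.
- move=> u; have [k1 [k2 [k3 [k4 [k5 [k6 ->]]]]]] := frame_spans u.
  exists k1, (k2 - k1 * r1), (k3 - k1 * s1), (k4 - k1 * r2), (k5 - k1 * s2), (k6 / s).
  by rewrite /e1; mod_field.
- have hyp u : u \in [:: e1; z; J z; w; J w] -> m n u = 0.
    by rewrite !inE => /or4P[|||/orP[]] /eqP ->; rewrite /e1 ?dot_simp !frame_orthogonal ?mulr0 ?addr0.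
  by move=> u u' uA u'A; apply: abA; apply: hyp.
- rewrite /e1 !bracket_simp DJn vE Dz Dw frame_D_Jz frame_D_Jw.
  have -> : p1 = a * r1 + s1 * b1 by rewrite -E1; ring.
  have -> : q1 = a * s1 - r1 * b1 by rewrite -E2; ring.
  have -> : p2 = a * r2 + s2 * b2 by rewrite -E3; ring.
  have -> : q2 = a * s2 - r2 * b2 by rewrite -E4; ring.
  mod_ring.
- by rewrite bracket_simp Dz scalerA.
- by rewrite bracket_simp frame_D_Jz scalerA mulrN.
- by rewrite bracket_simp Dw scalerA.
- by rewrite bracket_simp frame_D_Jw scalerA mulrN.
Qed.

(** On the line where [D] vanishes the drift cannot be changed. If it is nonzero
    there, it serves as the basis vector [x1]. *)
Lemma normal_form_with_drift : a = 0 -> b1 = 0 -> b2 != 0 ->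
  normal_form g 0 0 0 1 \/ normal_form g 0 1 0 1.
Proof.
move=> a0 b10 b20; have [p1 [q1 [p2 [q2 vE]]]] := drift_coordinates.
have [|r2 [s2 [E3 E4]]] := @resolvent R a b2 p2 q2; first by right.
move: E3 E4; rewrite a0 !mul0r => E3 E4.
pose e1 := J n + r2 *: w + s2 *: J w.
have De1 : D e1 = p1 *: z + q1 *: J z.
  rewrite /e1 !bracket_simp DJn vE Dw frame_D_Jw a0.
  have -> : p2 = s2 * b2 by rewrite -[RHS]addr0 -E3; ring.
  have -> : q2 = - (r2 * b2) by rewrite -[RHS]addr0 -E4; ring.
  mod_ring.
have [[p10 q10]|pq0] : (p1 = 0 /\ q1 = 0) \/ p1 ^+ 2 + q1 ^+ 2 != 0.
  case: (eqVneq (p1 ^+ 2 + q1 ^+ 2) 0) => [/eqP|]; last by right.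
  by rewrite paddr_eq0 ?sqr_ge0 // !sqrf_eq0 => /andP[/eqP-> /eqP->]; left.
  left; apply: (@normal_form_of_basis R g e1 z (J z) w (J w) (b2^-1 *: n)) => //.
  - move=> u; have [k1 [k2 [k3 [k4 [k5 [k6 ->]]]]]] := frame_spans u.
    exists k1, k2, k3, (k4 - k1 * r2), (k5 - k1 * s2), (k6 * b2).
    by rewrite /e1; mod_field.
  - have hyp u : u \in [:: e1; z; J z; w; J w] -> m n u = 0.
      by rewrite !inE => /or4P[|||/orP[]] /eqP ->; rewrite /e1 ?dot_simp !frame_orthogonal ?mulr0 ?addr0.
    by move=> u u' uA u'A; apply: abA; apply: hyp.
  - by rewrite linearZl_LR De1 p10 q10; mod_ring.
  - by rewrite bracket_simp Dz b10; mod_ring.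
  - by rewrite bracket_simp frame_D_Jz b10; mod_ring.
  - by rewrite bracket_simp Dw scalerA mulVf.
  - by rewrite bracket_simp frame_D_Jw scalerA mulrN mulVf.
right.
(* [e6] is [n] divided by [b2], which makes [[e6, e1]] equal to [x1]; the vector [y1]
   only has to complete [x1] to a basis of the first line. *)
pose x1 := b2^-1 *: (p1 *: z + q1 *: J z).
pose y1 := p1 *: J z - q1 *: z.
apply: (@normal_form_of_basis R g e1 x1 y1 w (J w) (b2^-1 *: n)) => //.
- move=> u; have [k1 [k2 [k3 [k4 [k5 [k6 ->]]]]]] := frame_spans u.
  exists k1, (b2 * (k2 * p1 + k3 * q1) / (p1 ^+ 2 + q1 ^+ 2)),
    ((k3 * p1 - k2 * q1) / (p1 ^+ 2 + q1 ^+ 2)), (k4 - k1 * r2), (k5 - k1 * s2), (k6 * b2).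
  by rewrite /e1 /x1 /y1; to_scalars; field; rewrite b20 pq0.
- have hyp u : u \in [:: e1; x1; y1; w; J w] -> m n u = 0.
    by rewrite !inE => /or4P[|||/orP[]] /eqP ->; rewrite /e1 /x1 /y1 ?dot_simp !frame_orthogonal
     ?mulr0 ?addr0 ?oppr0 ?mulr0 ?addr0.
  by move=> u u' uA u'A; apply: abA; apply: hyp.
- by rewrite linearZl_LR De1 /x1; mod_ring.
- by rewrite /x1 !bracket_simp Dz frame_D_Jz b10; mod_ring.
- by rewrite /y1 !bracket_simp Dz frame_D_Jz b10; mod_ring.
- by rewrite bracket_simp Dw scalerA mulVf.
- by rewrite bracket_simp frame_D_Jw scalerA mulrN mulVf.
Qed.

(** In this case every bracket is a multiple of the drift, and the drift is
    central. *)
Lemma nilpotent_degenerate : a = 0 -> b1 = 0 -> b2 = 0 -> nilpotent_lie g.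
Proof.
move=> a0 b10 b20.
have Dv u : exists k, D u = k *: v.
  have [k1 [k2 [k3 [k4 [k5 [k6 ->]]]]]] := frame_spans u; exists k1.
  by rewrite !bracket_simp DJn Dz Dw frame_D_Jz frame_D_Jw bracket_alternating a0 b10 b20; mod_ring.
have bracketE u u' : bracket u u' = m n u *: D u' - m n u' *: D u.
  have [nn _ _ _ _] := F.
  pose x := u - m n u *: n; pose x' := u' - m n u' *: n.
  have : bracket x x' = 0 by apply: abA; rewrite !dot_simp nn mulr1 subrr.
  rewrite /x /x' !bracket_simp bracket_alternating (bracketC u n) => E.
  apply/eqP; rewrite -subr_eq0 -E; apply/eqP; mod_ring.
have br_sub (U V W : {vspace g}) :
    (forall u v, u \in U -> v \in V -> bracket u v \in W) -> (bracket_space U V <= W)%VS.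
  move=> sub; apply/span_subvP => x /allpairsP[[u u'] /= [uU u'V ->]].
  by apply: sub; apply: vbasis_mem.
exists 2%N; apply/eqP; rewrite -subv0; apply: (br_sub) => u u' _ /=.
have : (bracket_space {:g} {:g} <= <[v]>)%VS.
  apply: br_sub => x y _ _; rewrite bracketE.
  have [k ->] := Dv x; have [k' ->] := Dv y.
  by rewrite !scalerA -scalerBl memvZ ?memv_line.
move=> /subvP sub /sub /vlineP[k ->].
have [nv _] := Av; have [k1 Dv'] := Dv v; rewrite bracket_simp bracketE nv scale0r subr0.
suff -> : D v = 0 by rewrite !scaler0 mem0v.
have [p1 [q1 [p2 [q2 ->]]]] := drift_coordinates.
by rewrite !bracket_simp Dz Dw frame_D_Jz frame_D_Jw b10 b20; mod_ring.
Qed.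

End Classification.

Lemma unitary_frame_swap (R : rcfType) (g : lieAlgebra R) (J : 'End(g))
    (m : {dot g for idfun}) (n z w : g) :
    (forall x, J (J x) = - x) -> (forall x y, m (J x) (J y) = m x y) ->
  unitary_frame J m n z w -> unitary_frame J m n w z.
Proof.
move=> J2 mJJ [nn zz ww [nz Jnz nw Jnw] [zw Jzw]].
by split=> //; split; rewrite (orthogonal_lines J2 mJJ zw Jzw).
Qed.

Lemma admits_normal_form (R : rcfType) (g : lieAlgebra R) :
    \dim {:g} = 6 -> almost_abelian g -> ~ nilpotent_lie g ->
  admits_SKT_with_holomorphic_poisson g -> poisson_normal_forms g.
Proof.
move=> dim6 abel nnil [J [m [[[[J2 NJ] mJJ] skt] [pi [hol pi0]]]]].
have [n [nn abA derA]] := unit_normal m abel.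
have [z [w [a1 [b1 [a2 [b2 [F Dz Dw E1 E2]]]]]]] :=
  SKT_diagonal J2 mJJ dim6 NJ nn abA derA skt.
have DJn := D_Jn J m n; have Av := core_drift J2 mJJ nn derA.
have E3 := Poisson_eigenvalues J2 NJ mJJ dim6 abA F Av DJn
  (l1 := a1 +i* b1) (l2 := a2 +i* b2) Dz Dw hol pi0.
move: (weight J m n) (drift J m n) DJn Av E1 E2 E3 => a v DJn Av E1 E2 E3.
(* If [a + l1 = 0], then [a1 = - a] is [0] or [- a / 2], so that [a = 0]; if
   [l1 + l2 = 0], two real parts in [{0, - a / 2}] have sum zero. *)
have [a10 a20 cases] : [/\ a1 = 0, a2 = 0 & b1 + b2 = 0 \/ a = 0 /\ (b1 = 0 \/ b2 = 0)].
  move/eqP: E1 E2 E3; rewrite mulf_eq0 => /orP[/eqP H1|/eqP H1] /eqP;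
  rewrite mulf_eq0 => /orP[/eqP H2|/eqP H2] /eqP;
  rewrite !mulf_eq0 !eq_complex /= => /orP[/orP[]|] /andP[/eqP A /eqP B];
  split; try lra;
  first [left; lra | right; split; [lra|left; lra] | right; split; [lra|right; lra]].
have {}Dz : bracket n z = b1 *: J z by rewrite Dz a10 scale0r add0r.
have {}Dw : bracket n w = b2 *: J w by rewrite Dw a20 scale0r add0r.
have killed s := @normal_form_without_drift R g J m J2 mJJ dim6 NJ n abA z w v a b1 b2 F Av DJn Dz Dw s.
rewrite /poisson_normal_forms.
have [a0|a0] := eqVneq a 0; last first.
  have {cases} b2E : b2 = - b1 by case: cases => [|[/eqP]]; [lra|rewrite (negPf a0)].
  have [b10|b10] := eqVneq b1 0.
    right; left; have := killed a^-1 _ (or_introl a0) (or_introl a0).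
    by rewrite b2E b10 mulVf // oppr0 mulr0 invr_eq0; apply.
  left; exists (b1^-1 * a); split; first by apply/eqP; rewrite mulf_neq0 ?invr_eq0.
  have := killed b1^-1 _ (or_introl a0) (or_introl a0).
  by rewrite b2E mulrN mulVf // invr_eq0; apply.
have [b10|b10] := eqVneq b1 0; have [b20|b20] := eqVneq b2 0.
- by case: nnil; exact: (nilpotent_degenerate J2 mJJ dim6 NJ abA F Av DJn Dz Dw).
- have [|] := normal_form_with_drift J2 mJJ dim6 NJ abA F Av DJn Dz Dw a0 b10 b20; tauto.
- have Fs := unitary_frame_swap J2 mJJ F.
  have [|] := normal_form_with_drift J2 mJJ dim6 NJ abA Fs Av DJn Dw Dz a0 b20 b10; tauto.
have b2E : b2 = - b1.
  by case: cases => [|[_ [/eqP|/eqP]]]; [lra|rewrite (negPf b10)|rewrite (negPf b20)].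
do 4 right; have := killed b1^-1 _ (or_intror b10) (or_intror b20).
by rewrite b2E a0 mulr0 mulrN mulVf // invr_eq0; apply.
Qed.

(** * Hermitian and Poisson structures on the normal forms *)

Lemma multilinear_zero (C : fieldType) (W : lmodType C) k (al : k.-tuple W -> C) t i :
  multilinear al -> tnth t i = 0 -> al t = 0.
Proof.
move=> alM ti0; have tE : tset t i 0 = t.
  by apply: eq_from_tnth => j; rewrite tnth_mktuple; case: eqP => // ->.
have := alM t i (-1) 0 0; rewrite scaler0 addr0 tE mulN1r addNr.
by [].
Qed.

(** A bivector with commuting factors has zero Schouten square: each term of the
    square contains the bracket of two of the factors. It is holomorphic when its
    plane is stable under dbar with trace zero, the trace being the eigenvalue of dbar
    on the bivector. *)
Lemma decomposable_poisson (R : rcfType) (g : lieAlgebra R) (J : 'End(g))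
    (u v : g) (f h : complexification g -> R[i])
    (U := iota10 J u) (V := iota10 J v) :
    (forall x, J (J x) = - x) ->
    cbracket U V = 0 ->
    (forall r, exists p q s t, [/\ dbar J (iota01 J r) U = p *: U + q *: V,
      dbar J (iota01 J r) V = s *: U + t *: V & p + t = 0]) ->
    functional f -> functional h -> wedge f h [tuple U; V] != 0 ->
  is_holomorphic_poisson J [:: [tuple U; V]] /\ ~ mv_zero [:: [tuple U; V]].
Proof.
move=> J2 UV0 dUV fl hl fh0.
have VU0 : cbracket V U = 0 by rewrite cbracketC UV0 oppr0.
have self x : cbracket x x = 0.
  apply: injective_projections; rewrite /= ?bracket_alternating ?subrr //.
  by rewrite (bracketC x.1 x.2) addNr.
split; last first.
  move=> /(_ (wedge f h)); rewrite big_seq1 => z.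
  by move/eqP: fh0; apply; apply: z; [apply: wedge_multilinear|apply: wedge_alternating].
split.
- move=> t i; rewrite inE => /eqP ->.
  by elim/ord2P: i; apply: in10_iota.
- move=> x /(in01P J2) -> al alM alA; rewrite big_dbar_bivector big_seq1.
  have [p [q [s [t [dU dV pt]]]]] := dUV x.1.
  rewrite -[tnth _ ord0]/U -[tnth _ ord_max]/V dU dV.
  rewrite (bilinear2Dl alM) (bilinear2Dr alM) !(bilinear2Zl alM) !(bilinear2Zr alM).
  rewrite !(alternating2 alA) !mulr0 addr0 add0r -mulrDl pt mul0r //.
- move=> al alM alA; rewrite /schouten /= cats0 big_seq big1 // => t.
  case/allpairsP => [[j k]] /= [_ _ ->].
  apply: (multilinear_zero (i := ord0) alM); rewrite /tnth /=.
  have -> : cbracket (tnth [tuple U; V] j) (tnth [tuple U; V] k) = 0.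
    by elim/ord2P: j; elim/ord2P: k; rewrite /tnth /= ?self.
  by rewrite scaler0.
Qed.

Section Backward.
Variables (R : rcfType) (g : lieAlgebra R) (a c mu1 mu2 : R).
Variable phi : {linear 'rV[R]_6 -> g}.
Variable psi : g -> 'rV[R]_6.
Hypothesis phiK : cancel phi psi.
Hypothesis psiK : cancel psi phi.
Hypothesis phiB : forall p q,
  bracket (phi p) (phi q) = phi (nf_bracket a c mu1 mu2 p q).

Definition coordinate (i : nat) (x : g) : R := psi x 0 (inord i).
Local Notation k := coordinate.

Lemma psi_linear : linear psi.
Proof. by move=> s x y; apply: (can_inj phiK); rewrite linearP !psiK. Qed.

Lemma coordinate_simp i : (forall x y, k i (x + y) = k i x + k i y) *
  (forall x, k i (- x) = - k i x) * (forall s x, k i (s *: x) = s * k i x) * (k i 0 = 0).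
Proof.
have k0 : k i 0 = 0.
  by have := psi_linear (-1) 0 0; rewrite /k scaler0 addr0 scaleN1r addNr => ->; rewrite mxE.
have kZ s x : k i (s *: x) = s * k i x.
  rewrite -[s *: x]addr0 /k psi_linear mxE mxE.
  by have := k0; rewrite /k => ->; rewrite addr0.
have kD x y : k i (x + y) = k i x + k i y.
  by rewrite -[x]scale1r /k psi_linear mxE mxE mul1r scale1r.
by split; [split; [split|]|] => // x; rewrite -scaleN1r kZ mulN1r.
Qed.

Lemma coordinate_ext x y : k 0 x = k 0 y -> k 1 x = k 1 y -> k 2 x = k 2 y ->
  k 3 x = k 3 y -> k 4 x = k 4 y -> k 5 x = k 5 y -> x = y.
Proof. by move=> *; apply: (can_inj psiK); apply: row6_ext. Qed.

Definition minor i (x y : g) := k 5 x * k i y - k 5 y * k i x.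

Lemma coordinate_bracket x y :
  (k 0 (bracket x y) = a * minor 0 x y) *
  (k 1 (bracket x y) = c * minor 0 x y - mu1 * minor 2 x y) *
  (k 2 (bracket x y) = mu1 * minor 1 x y) *
  (k 3 (bracket x y) = - mu2 * minor 4 x y) *
  (k 4 (bracket x y) = mu2 * minor 3 x y) *
  (k 5 (bracket x y) = 0).
Proof.
have -> : bracket x y = phi (nf_bracket a c mu1 mu2 (psi x) (psi y)).
  by rewrite -phiB !psiK.
by rewrite /k phiK /nf_bracket /= !row6E.
Qed.

(** [J e6 = e1], [J x1 = y1] and [J x2 = y2]. *)
Definition nf_J0 (x : g) : g :=
  phi (row6 (k 5 x) (- k 2 x) (k 1 x) (- k 4 x) (k 3 x) (- k 0 x)).

Lemma nf_J0_linear : linear nf_J0.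
Proof.
move=> s x y; rewrite /nf_J0 -linearP; congr (phi _).
by apply: row6_ext; rewrite !mxE !inordK //= !coordinate_simp; ring.
Qed.

Definition nf_J : 'End(g) :=
  linfun (HB.pack nf_J0 (GRing.isLinear.Build R g g _ _ nf_J0_linear) : {linear g -> g}).
Local Notation J := nf_J.

Lemma coordinate_J x : (k 0 (J x) = k 5 x) * (k 1 (J x) = - k 2 x) * (k 2 (J x) = k 1 x) *
  (k 3 (J x) = - k 4 x) * (k 4 (J x) = k 3 x) * (k 5 (J x) = - k 0 x).
Proof. by rewrite /J lfunE /= /nf_J0 /k phiK !row6E. Qed.

Lemma nf_J2 x : J (J x) = - x.
Proof. by apply: coordinate_ext; rewrite !coordinate_J coordinate_simp // opprK. Qed.

Lemma nf_nijenhuis x y : nijenhuis J x y = 0.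
Proof.
rewrite /nijenhuis; apply: coordinate_ext;
  rewrite !(coordinate_simp, coordinate_J, coordinate_bracket) /minor !(coordinate_J); ring.
Qed.

Definition nf_dot (x y : g) : R :=
  k 0 x * k 0 y + k 1 x * k 1 y + k 2 x * k 2 y + k 3 x * k 3 y
  + k 4 x * k 4 y + k 5 x * k 5 y.

Lemma nf_dot_bilinear : bilinear_for *%R (idfun \; *%R) nf_dot.
Proof. by split=> u s x y; rewrite /nf_dot !coordinate_simp /=; ring. Qed.

Lemma nf_dot_sym x y : nf_dot x y = (-1) ^+ false * idfun (nf_dot y x).
Proof. by rewrite /nf_dot expr0 /=; ring. Qed.

Lemma nf_dot_pos x : x != 0 -> 0 < nf_dot x x.
Proof.
move=> x0; rewrite lt0r -/(nf_dot x x); apply/andP; split; last first.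
  by rewrite /nf_dot !addr_ge0 // -expr2 sqr_ge0.
apply: contraNneq x0; rewrite /nf_dot -!expr2 => E.
have sq i : 0 <= k i x ^+ 2 by apply: sqr_ge0.
have z i : k i x ^+ 2 = 0 -> k i x = 0 by move/eqP; rewrite sqrf_eq0 => /eqP.
have := (sq 0%N, sq 1%N, sq 2%N, sq 3%N, sq 4%N, sq 5%N) => -[[[[[s0 s1] s2] s3] s4] s5].
by apply/eqP; apply: coordinate_ext; rewrite coordinate_simp; apply: z; lra.
Qed.

HB.instance Definition _ := bilinear_isBilinear.Build R g g R *%R (idfun \; *%R)
  nf_dot nf_dot_bilinear.
HB.instance Definition _ := isHermitianSesquilinear.Build R g false idfun nf_dot nf_dot_sym.
HB.instance Definition _ := isDotProduct.Build R g nf_dot nf_dot_pos.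
Definition nf_metric : {dot g for idfun} := nf_dot.
Local Notation m := nf_metric.

Lemma nf_hermitian x y : m (J x) (J y) = m x y.
Proof. by rewrite -![m _ _]/(nf_dot _ _) /nf_dot !coordinate_J; ring. Qed.

Local Notation gC := (complexification g).
Local Notation om := (fundamental_form J m).
Definition ccoordinate i : gC -> R[i] := cextend (k i).
Local Notation K := ccoordinate.

Lemma ccoordinate_functional i : functional (K i).
Proof. by apply: cextend_functional => s x y; rewrite !coordinate_simp. Qed.

Lemma ccoordinate_simp i : (forall x y, K i (x + y) = K i x + K i y) *
  (forall x, K i (- x) = - K i x) * (forall s x, K i (s *: x) = s * K i x).
Proof.
have K0 : K i 0 = 0 by rewrite /K /cextend /= coordinate_simp.
have KZ s x : K i (s *: x) = s * K i x.
  by rewrite -[s *: x]addr0 ccoordinate_functional K0 addr0.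
split; [split|] => // [x y|x]; last by rewrite -scaleN1r KZ mulN1r.
by rewrite -[x]scale1r ccoordinate_functional mul1r scale1r.
Qed.

Definition cminor i (x y : gC) := K 5 x * K i y - K 5 y * K i x.

Lemma ccoordinate_bracket (x y : gC) :
  (K 0 (cbracket x y) = a%:C * cminor 0 x y) *
  (K 1 (cbracket x y) = c%:C * cminor 0 x y - mu1%:C * cminor 2 x y) *
  (K 2 (cbracket x y) = mu1%:C * cminor 1 x y) *
  (K 3 (cbracket x y) = - mu2%:C * cminor 4 x y) *
  (K 4 (cbracket x y) = mu2%:C * cminor 3 x y) *
  (K 5 (cbracket x y) = 0).
Proof.
rewrite /K /cextend /cbracket /cext_prod /cminor /K /cextend /=.
rewrite !coordinate_simp !coordinate_bracket /minor.
by do !split; apply: complex_ext => /=; ring.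
Qed.

Lemma ccoordinate_J (x : gC) : (K 0 (cext J x) = K 5 x) * (K 1 (cext J x) = - K 2 x) *
  (K 2 (cext J x) = K 1 x) * (K 3 (cext J x) = - K 4 x) *
  (K 4 (cext J x) = K 3 x) * (K 5 (cext J x) = - K 0 x).
Proof. by rewrite /K /cextend /= !coordinate_J. Qed.

Lemma fundamental_coordinates (x y : gC) : om [tuple x; y] =
  K 5 x * K 0 y - K 0 x * K 5 y - K 2 x * K 1 y + K 1 x * K 2 y
  - K 4 x * K 3 y + K 3 x * K 4 y.
Proof.
rewrite fundamental_formE -![m _ _]/(nf_dot _ _) /nf_dot !coordinate_J /K /cextend.
by apply: complex_ext => /=; ring.
Qed.

(** The endomorphism [ad e6] is skew on the planes of [x1, y1] and [x2, y2], and
    the terms in [a] form a vanishing determinant; only the drift [c x1] is left. *)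
Lemma d_fundamental_coordinates (x y z : gC) : ce_diff om [tuple x; y; z] =
  - c%:C * (cminor 0 x y * K 2 z - cminor 0 x z * K 2 y + cminor 0 y z * K 2 x).
Proof. by rewrite ce_diff2 !fundamental_coordinates !ccoordinate_bracket /cminor; ring. Qed.

(** The (0,1)-part of the coordinate along [y1]. *)
Definition theta (x : gC) := 2^-1 * (K 2 x + 'i%C * K 1 x).

(** The form [cminor 0] is the area form of the plane of [e6, e1]. It has type
    (1,1), so the part of bidegree (1,2) replaces the other factor of [d omega] by its
    (0,1)-part. *)
Lemma delbar_fundamental_coordinates (x y z : gC) : bidegree_part J 1 (ce_diff om) [tuple x; y; z] =
  - c%:C * (cminor 0 x y * theta z - cminor 0 x z * theta y + cminor 0 y z * theta x).
Proof.
rewrite bidegree1_3 !d_fundamental_coordinates.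
have th u : K 2 (proj01 J u) = theta u by rewrite !ccoordinate_simp ccoordinate_J.
have ii : 'i%C * 'i%C = -1 :> R[i] by rewrite -expr2 sqr_i.
have p10 u : K 0 (proj10 J u) = - 'i%C * K 5 (proj10 J u).
  have : in10 J (proj10 J u) by rewrite (proj10E nf_J2); apply: (in10_iota nf_J2).
  move=> /(congr1 (K 0)); rewrite ccoordinate_J ((ccoordinate_simp 0).2 'i%C) => ->.
  by rewrite mulrA mulNr ii opprK mul1r.
have p01 u : K 0 (proj01 J u) = 'i%C * K 5 (proj01 J u).
  have : in01 J (proj01 J u) by rewrite (proj01E nf_J2); apply: (in01_iota nf_J2).
  move=> /(congr1 (K 0)); rewrite ccoordinate_J ((ccoordinate_simp 0).2 (- 'i%C)) => ->.
  by rewrite mulrA mulrN ii opprK mul1r.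
have K5s u : K 5 u = K 5 (proj10 J u) + K 5 (proj01 J u).
  by rewrite -ccoordinate_simp -(proj_split nf_J2).
have K0s u : K 0 u = K 0 (proj10 J u) + K 0 (proj01 J u).
  by rewrite -ccoordinate_simp -(proj_split nf_J2).
rewrite !th /cminor !(K0s x) !(K0s y) !(K0s z) !(K5s x) !(K5s y) !(K5s z) !p10 !p01.
ring.
Qed.

(** Up to a constant, [delbar omega] is the wedge of the coordinates along [e6]
    and [e1] and of [theta]. The first of them is closed and divides the differentials
    of the other two, so every term of the differential contains it twice. *)
Lemma d_delbar_fundamental (x y z w : gC) :
  ce_diff (bidegree_part J 1 (ce_diff om)) [tuple x; y; z; w] = 0.
Proof.
rewrite ce_diff3 !delbar_fundamental_coordinates /cminor /theta !ccoordinate_bracket /cminor; ring.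
Qed.

Lemma nf_SKT : is_SKT J m.
Proof.
split; first by split; [split; [exact: nf_J2|exact: nf_nijenhuis]|exact: nf_hermitian].
move=> t; rewrite (del_delbar_fundamental nf_J2 nf_hermitian).
apply: big1 => S _; move: [tuple _ | _ < _].
move=> t'; case/tupleP: t' => x t'; case/tupleP: t' => y t'; case/tupleP: t' => z t'.
by case/tupleP: t' => w t'; rewrite (tuple0 t'); apply: d_delbar_fundamental.
Qed.

Lemma coordinate_phi (c0 c1 c2 c3 c4 c5 : R) (x := phi (row6 c0 c1 c2 c3 c4 c5)) :
  (k 0 x = c0) * (k 1 x = c1) * (k 2 x = c2) * (k 3 x = c3) * (k 4 x = c4) * (k 5 x = c5).
Proof. by rewrite /k phiK !row6E. Qed.

Lemma cact_plane (s t : R) (x : g) :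
  (s +i* t) *: iota10 J x = iota10 J (s *: x + t *: J x).
Proof. by rewrite (cscale_iota10 nf_J2). Qed.

Let x1 := phi (row6 0 1 0 0 0 0).
Let x2 := phi (row6 0 0 0 1 0 0).
Let e6 := phi (row6 0 0 0 0 0 1).

Lemma dbar_x1 r : dbar J (iota01 J r) (iota10 J x1) =
  (mu1 * k 0 r +i* (mu1 * k 5 r)) *: iota10 J x1.
Proof.
rewrite (dbar_iota nf_J2 nf_nijenhuis) cact_plane; congr iota10.
by apply: coordinate_ext; rewrite !(coordinate_simp, coordinate_J, coordinate_bracket) /minor ?coordinate_J /x1 ?coordinate_phi; ring.
Qed.

Lemma dbar_x2 r : dbar J (iota01 J r) (iota10 J x2) =
  (mu2 * k 0 r +i* (mu2 * k 5 r)) *: iota10 J x2.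
Proof.
rewrite (dbar_iota nf_J2 nf_nijenhuis) cact_plane; congr iota10.
by apply: coordinate_ext; rewrite !(coordinate_simp, coordinate_J, coordinate_bracket) /minor ?coordinate_J /x2 ?coordinate_phi; ring.
Qed.

Lemma dbar_e6 r : a = 0 -> dbar J (iota01 J r) (iota10 J e6) =
  (- c * k 0 r +i* (- c * k 5 r)) *: iota10 J x1.
Proof.
move=> a0; rewrite (dbar_iota nf_J2 nf_nijenhuis) cact_plane; congr iota10.
by apply: coordinate_ext; rewrite !(coordinate_simp, coordinate_J, coordinate_bracket) /minor ?coordinate_J /x1 /e6 ?coordinate_phi ?a0; ring.
Qed.

(** With [mu1 + mu2 = 0] the bivector is spanned by the (1,0)-vectors above [x1]
    and [x2]; with [a = mu1 = 0] by those above [e6] and [x1], on which dbar is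
    nilpotent. *)
Lemma nf_admits : mu1 + mu2 = 0 \/ a = 0 /\ mu1 = 0 ->
  admits_SKT_with_holomorphic_poisson g.
Proof.
move=> cond; exists J, m; split; first exact: nf_SKT.
case: cond => [mu12|[a0 mu10]].
  exists [:: [tuple iota10 J x1; iota10 J x2]].
  apply: (decomposable_poisson (f := K 1) (h := K 3) nf_J2).
  - rewrite /cbracket /cext_prod /=.
    by apply: injective_projections => /=; apply: coordinate_ext;
      rewrite !(coordinate_simp, coordinate_bracket) /minor ?(coordinate_simp, coordinate_J) /x1 /x2 ?coordinate_phi; ring.
  - move=> r; rewrite dbar_x1 dbar_x2; do 4 eexists; split.
    + by rewrite -[LHS]addr0 -[in LHS](scale0r (iota10 J x2)).
    + by rewrite -[LHS]add0r -[in LHS](scale0r (iota10 J x1)).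
    + apply: complex_ext => /=; rewrite -mulrDl mu12 mul0r //.
  - exact: ccoordinate_functional.
  - exact: ccoordinate_functional.
  - rewrite wedgeE /K /cextend /= !coordinate_simp !coordinate_J /x1 /x2 !coordinate_phi.
    by rewrite eq_complex /= !(mulr0, mul0r, mulr1, oppr0, subr0, addr0) oner_eq0.
exists [:: [tuple iota10 J e6; iota10 J x1]].
apply: (decomposable_poisson (f := K 5) (h := K 1) nf_J2).
- rewrite /cbracket /cext_prod /=.
  by apply: injective_projections => /=; apply: coordinate_ext;
    rewrite !(coordinate_simp, coordinate_bracket) /minor ?(coordinate_simp, coordinate_J) /x1 /e6 ?coordinate_phi ?mu10; ring.
- move=> r; rewrite dbar_x1 (dbar_e6 _ a0); do 4 eexists; split.
  + by rewrite -[LHS]add0r -[in LHS](scale0r (iota10 J e6)).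
  + by rewrite mu10 !mul0r -[LHS]add0r -[in LHS](scale0r (iota10 J e6)).
  + by apply: complex_ext => /=; rewrite addr0.
- exact: ccoordinate_functional.
- exact: ccoordinate_functional.
- rewrite wedgeE /K /cextend /= !coordinate_simp !coordinate_J /x1 /e6 !coordinate_phi.
  by rewrite eq_complex /= !(mulr0, mul0r, mulr1, oppr0, subr0, addr0) oner_eq0.
Qed.
End Backward.

Lemma normal_form_admits (R : rcfType) (g : lieAlgebra R) a c mu1 mu2 :
    normal_form g a c mu1 mu2 -> mu1 + mu2 = 0 \/ a = 0 /\ mu1 = 0 ->
  admits_SKT_with_holomorphic_poisson g.
Proof. by case=> phi [[psi phiK psiK] phiB]; apply: nf_admits phiK psiK phiB. Qed.

(** * Direct summands and trace of the adjoint representation *)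

Section Abelian.
Variables (F : fieldType) (V : vectType F).
Definition zero_bracket (x y : V) : V := 0.
Fact zero_bracket_bilinear : bilinear_for *:%R *:%R zero_bracket.
Proof. by split=> u s x y; rewrite /zero_bracket /= scaler0 addr0. Qed.
HB.instance Definition _ := bilinear_isBilinear.Build F V V V _ _
  zero_bracket zero_bracket_bilinear.
Fact zero_bracket_jacobi x y z :
  zero_bracket x (zero_bracket y z) + zero_bracket y (zero_bracket z x)
    + zero_bracket z (zero_bracket x y) = 0.
Proof. by rewrite /zero_bracket !addr0. Qed.
Definition abelian_lie : lieAlgebra F :=
  @LieAlgebra F V zero_bracket (fun=> erefl) zero_bracket_jacobi.
End Abelian.

Section Subalgebra.
Variables (F : fieldType) (g : lieAlgebra F) (U : {vspace g}).
Hypothesis closed : forall x y, x \in U -> y \in U -> bracket x y \in U.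
Definition sub_bracket (x y : subvs_of U) : subvs_of U :=
  vsproj U (bracket (vsval x) (vsval y)).
Fact sub_bracket_bilinear : bilinear_for *:%R *:%R sub_bracket.
Proof.
have proj_lin k (x y : g) : vsproj U (k *: x + y) = k *: vsproj U x + vsproj U y.
  exact: linearP.
by split=> u s x y; rewrite /applyr_head /applyr /sub_bracket -proj_lin;
  congr (vsproj U _); rewrite [vsval (_ + _)]linearP !bracket_simp.
Qed.
HB.instance Definition _ := bilinear_isBilinear.Build F _ _ _ _ _
  sub_bracket sub_bracket_bilinear.
Lemma sub_bracketE x y : vsval (sub_bracket x y) = bracket (vsval x) (vsval y).
Proof. by rewrite vsprojK // closed ?subvsP. Qed.
Fact sub_bracket_alternating x : sub_bracket x x = 0.
Proof. by apply: val_inj; rewrite /= -[val _]/(vsval _) sub_bracketE bracket_alternating. Qed.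
Fact sub_bracket_jacobi x y z :
  sub_bracket x (sub_bracket y z) + sub_bracket y (sub_bracket z x)
    + sub_bracket z (sub_bracket x y) = 0.
Proof. by apply: val_inj; rewrite /= !sub_bracketE bracket_jacobi. Qed.
Definition lie_subalgebra : lieAlgebra F :=
  LieAlgebra sub_bracket_alternating sub_bracket_jacobi.
End Subalgebra.

Lemma dim_gt0 (F : fieldType) (V : vectType F) (x : V) : x != 0 -> (0 < \dim {:V})%N.
Proof.
by move=> x0; rewrite lt0n dimv_eq0; apply: contraNneq x0 => E; rewrite -memv0 -E memvf.
Qed.

(** The kernel of [f] is an ideal, as it contains all brackets, and the central
    line of [y] is a complement. *)
Lemma central_summand (F : fieldType) (g : lieAlgebra F) (f : {scalar g}) (y u : g) :
    f y = 1 -> (forall x z, f (bracket x z) = 0) -> (forall x, bracket y x = 0) ->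
    u != 0 -> f u = 0 ->
  decomposable g.
Proof.
move=> fy fB yB u0 fu.
pose U : {vspace g} := lker (linfun (f : {linear g -> F^o})).
have UE x : (x \in U) = (f x == 0) by rewrite memv_ker lfunE.
have closed x z : x \in U -> z \in U -> bracket x z \in U by rewrite !UE fB.
pose g1 := lie_subalgebra closed.
pose g2 := abelian_lie F^o.
exists g1, g2; split.
- apply: (@dim_gt0 F g1 (vsproj U u)); apply: contraNneq u0 => E.
  by have uU : u \in U; [rewrite UE fu|rewrite -(vsprojK uU) E linear0].
- by apply: (@dim_gt0 F g2 (1 : F^o)); apply: oner_neq0.
have pU x : x - f x *: y \in U by rewrite UE linearB linearZ /= fy mulr1 subrr.
pose p0 (x : g) : lie_sum g1 g2 := (vsproj U (x - f x *: y), f x : F^o).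
have p_lin : linear p0.
  move=> s x z; congr (_, _); last by rewrite /= linearP.
  by rewrite /= -linearP; congr (vsproj U _); rewrite linearP; mod_ring.
pose p : {linear g -> lie_sum g1 g2} :=
  HB.pack p0 (GRing.isLinear.Build F g (lie_sum g1 g2) _ _ p_lin).
exists p; split.
  exists (fun xz : lie_sum g1 g2 => vsval xz.1 + (xz.2 : F) *: y) => [x|[x t]].
    by rewrite /p /= vsprojK // subrK.
  have fx : f (vsval x) = 0 by apply/eqP; rewrite -UE subvsP.
  have fxt : f (vsval x + t *: y) = t.
    by rewrite linearD linearZ /= fx fy mulr1 add0r.
  by rewrite /p /= /p0 fxt addrK vsvalK.
move=> x z; rewrite /p /= /p0 fB; congr (_, _).
apply: val_inj; rewrite /= (sub_bracketE closed) scale0r subr0.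
rewrite !vsprojK // ?UE ?fB // !bracket_simp (bracketC x y) !yB; mod_ring.
Qed.

Section UnimodularTrace.
Variables (R : fieldType) (g : lieAlgebra R) (a c mu1 mu2 : R).

(** The trace does not depend on the basis: both sides are computed by expanding
    each basis in the other. *)
Lemma trace_coordinates (h : 'End(g)) (phi : {linear 'rV[R]_6 -> g})
    (psi : g -> 'rV[R]_6) :
    cancel phi psi -> cancel psi phi ->
  \tr (passmx.mxof (vbasis {:g}) (vbasis {:g}) h) =
  \sum_(j < 6) psi (h (phi (delta_mx 0 j))) 0 j.
Proof.
move=> phiK psiK.
have psi_lin : linear psi.
  by move=> s x y; apply: (can_inj phiK); rewrite linearP !psiK.
pose Psi : {linear g -> 'rV[R]_6} := HB.pack psi (GRing.isLinear.Build R g _ _ _ psi_lin).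
pose e := vbasis {:g}.
have eP : basis_of {:g} e := vbasisP _.
transitivity (\sum_(i < \dim {:g}) coord e i (h e`_i)).
  by apply: eq_bigr => i _; rewrite /passmx.mxof !mxE /= passmx.vecof_delta.
transitivity (\sum_(i < \dim {:g}) \sum_(j < 6) Psi e`_i 0 j * coord e i (h (phi (delta_mx 0 j)))).
  apply: eq_bigr => i _; rewrite -{1}(psiK e`_i) [psi _]row_sum_delta !linear_sum.
  by apply: eq_bigr => j _; rewrite !linearZ.
rewrite exchange_big; apply: eq_bigr => j _ /=.
move: (h (phi _)) => v; rewrite -[psi v]/(Psi v).
rewrite [in RHS](coord_basis eP (memvf v)) linear_sum summxE.
by apply: eq_bigr => i _; rewrite linearZ mxE mulrC.
Qed.

(** The endomorphism [ad e6] is skew on the two planes, and the entry [c] is off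
    the diagonal, so its trace is [a]. *)
Lemma unimodular_normal_form :
  normal_form g a c mu1 mu2 -> unimodular g -> a = 0.
Proof.
case=> phi [[psi phiK psiK] phiB] /(_ (phi (row6 0 0 0 0 0 1))).
rewrite (trace_coordinates _ phiK psiK) => <-.
rewrite !big_ord_recl big_ord0 !lfunE /= !phiB !phiK /nf_bracket /= !mxE /=.
rewrite -!val_eqE /= !inordK //=; ring.
Qed.
End UnimodularTrace.

Section Decomposition.
Variables (R : rcfType) (g : lieAlgebra R) (a c mu1 mu2 : R).

(** If [mu1 = 0] the vector [y1] is central and no bracket has a component along
    it; if [c = 0], the same holds for [e1]. *)
Lemma normal_form_decomposable :
  normal_form g a c mu1 mu2 -> a = 0 -> mu1 = 0 \/ c = 0 -> decomposable g.
Proof.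
case=> phi [[psi phiK psiK] phiB] a0 cond.
have k_lin i : scalar (coordinate psi i).
  by move=> s x y; rewrite !(coordinate_simp phiK psiK).
pose k i : {scalar g} := HB.pack (coordinate psi i) (GRing.isLinear.Build R g R _ _ (k_lin i)).
pose e1 := phi (row6 1 0 0 0 0 0); pose y1 := phi (row6 0 0 1 0 0 0).
pose e6 := phi (row6 0 0 0 0 0 1).
have e6_neq0 : e6 != 0.
  apply/eqP => /(congr1 (k 5)); rewrite linear0 /k /= (coordinate_phi phiK) => /eqP.
  by rewrite oner_eq0.
case: cond => [mu10|c0].
- apply: (@central_summand R g (k 2) y1 e6) => //.
  + by rewrite /k /= (coordinate_phi phiK).
  + by move=> x z; rewrite /k /= (coordinate_bracket phiK psiK phiB) mu10 mul0r.
  + move=> x; apply: (coordinate_ext psiK); rewrite (coordinate_bracket phiK psiK phiB) ?(coordinate_simp phiK psiK);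
      rewrite /minor ?(coordinate_phi phiK) ?mu10; ring.
  + by rewrite /k /= (coordinate_phi phiK).
- apply: (@central_summand R g (k 0) e1 e6) => //.
  + by rewrite /k /= (coordinate_phi phiK).
  + by move=> x z; rewrite /k /= (coordinate_bracket phiK psiK phiB) a0 mul0r.
  + move=> x; apply: (coordinate_ext psiK); rewrite (coordinate_bracket phiK psiK phiB) ?(coordinate_simp phiK psiK);
      rewrite /minor ?(coordinate_phi phiK) ?a0 ?c0; ring.
  + by rewrite /k /= (coordinate_phi phiK).
Qed.
End Decomposition.

(** * The classification *)

Lemma admits_iff (R : rcfType) (g : lieAlgebra R) :
    \dim {:g} = 6 -> almost_abelian g -> ~ nilpotent_lie g ->
  admits_SKT_with_holomorphic_poisson g <-> poisson_normal_forms g.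
Proof.
move=> dim6 ab nn; split; first exact: admits_normal_form.
case=> [[p [_ nf]]|[nf|[nf|[nf|nf]]]]; apply: (normal_form_admits nf);
  rewrite ?subrr ?addr0; tauto.
Qed.

Lemma poisson_normal_forms_iff (R : rcfType) (g : lieAlgebra R) :
  poisson_normal_forms g <->
     (exists p : R, p <> 0 /\ lie_isomorphic g (k11 p)) \/
     lie_isomorphic g (k13 R) \/ lie_isomorphic g (k15 R) \/
     lie_isomorphic g (k23 R) \/ lie_isomorphic g (k25 R).
Proof.
have to (h : lieAlgebra R) a c mu1 mu2 : normal_form h a c mu1 mu2 ->
    normal_form g a c mu1 mu2 <-> lie_isomorphic g h.
  move=> nfh; split=> [nfg|iso]; first exact: normal_form_isomorphic nfg nfh.
  exact: normal_form_transport iso nfh.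
rewrite /poisson_normal_forms.
rewrite -(to _ _ _ _ _ (@normal_form_k13 R)) -(to _ _ _ _ _ (@normal_form_k15 R)).
rewrite -(to _ _ _ _ _ (@normal_form_k23 R)) -(to _ _ _ _ _ (@normal_form_k25 R)).
have k11P p : normal_form g p 0 1 (-1) <-> lie_isomorphic g (k11 p).
  exact: to (normal_form_k11 p).
split=> [[[p [p0 nf]]|nf]|[[p [p0 nf]]|nf]]; [left|right; exact: nf|left|right; exact: nf];
  by exists p; split=> //; apply/k11P.
Qed.

Theorem theorem4p1 (R : realType) (g : lieAlgebra R)
    (g_dim6 : \dim (fullv : {vspace g}) = 6)
    (g_almost_abelian : almost_abelian g)
    (g_non_nilpotent : ~ nilpotent_lie g) :
  (admits_SKT_with_holomorphic_poisson g <->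
     (exists p : R, p <> 0%R /\ lie_isomorphic g (k11 p)) \/
     lie_isomorphic g (k13 R) \/
     lie_isomorphic g (k15 R) \/
     lie_isomorphic g (k23 R) \/
     lie_isomorphic g (k25 R)) /\
  (unimodular g -> admits_SKT_with_holomorphic_poisson g ->
     decomposable g /\
     (lie_isomorphic g (k15 R) \/
      lie_isomorphic g (k23 R) \/
      lie_isomorphic g (k25 R))).
Proof.
rewrite -(poisson_normal_forms_iff g).
have iff := admits_iff g_dim6 g_almost_abelian g_non_nilpotent.
split=> [//|uni adm]; have /iff nfs := adm.
have models := (proj1 (poisson_normal_forms_iff g)) nfs.
have nz p c mu1 mu2 : normal_form g p c mu1 mu2 -> p <> 0 -> False.
  by move=> nf; apply; apply: unimodular_normal_form nf uni.
have one_neq0 : 1 <> 0 :> R by apply/eqP; apply: oner_neq0.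
split.
  case: nfs => [[p [p0 /nz]]|[/nz|[nf|[nf|nf]]]] //.
  - by apply: (normal_form_decomposable nf) => //; left.
  - by apply: (normal_form_decomposable nf) => //; left.
  - by apply: (normal_form_decomposable nf) => //; right.
case: nfs => [[p [p0 /nz]]|[/nz|[nf|[nf|nf]]]] //.
- by left; apply: normal_form_isomorphic nf (normal_form_k15 R).
- by right; left; apply: normal_form_isomorphic nf (normal_form_k23 R).
- by do 2 right; apply: normal_form_isomorphic nf (normal_form_k25 R).
Qed.
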